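(* Let $L$ be a finite connected flag simplicial complex with non-trivial finite fundamental group $\pi$, let $K$ be the universal cover of $L$, and let $G=BB_K\rtimes \pi$, where $\pi$ acts on the Bestvina-Brady group $BB_K$ via the action induced by deck transformations of $K$. Then $G$ is finitely presented and virtually torsion-free, and $G/\mathrm{Tor}(G)\cong BB_L$, which is recursively presented but not finitely presented.
   Context: For a group $G$, the torsion subgroup $\mathrm{Tor}(G)$ is the (normal) subgroup of $G$ generated by all elements of finite order. A flag complex is a simplicial complex in which every finite set of pairwise adjacent vertices spans a simplex (a clique complex). For a finite flag simplicial complex $L$, the right-angled Artin group $A_L$ is the group with generators the vertices of $L$ subject only to the relations that the two ends of each edge of $L$ commute. Let $f_L:A_L\to\mathbb{Z}$ be the homomorphism sending each generator to $1$; the Bestvina-Brady group is $BB_L=\ker f_L$. The universal cover $K$ of $L$ carries its induced simplicial structure (a finite flag complex, as $\pi$ is finite), and $\pi$ acts on $K$ by deck transformations. Permuting the vertices of $K$ induces an action of $\pi$ on $A_K$ by automorphisms preserving $f_K$, hence an action on $BB_K$. Known theorem of Bestvina and Brady: for a finite flag complex $L$, $BB_L$ is finitely generated if and only if $L$ is connected, and finitely presented if and only if $L$ is simply connected. A group is recursively presented if it has a presentation with finitely many generators and a recursively enumerable set of relators. A group is virtually torsion-free if it has a torsion-free subgroup of finite index. *)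

(* Defs.v *)
From HB Require Import structures.
From mathcomp Require Import all_boot all_order all_algebra.
From mathcomp Require Import generic_quotient finmap.
From mathcomp Require Import boolp classical_sets functions cardinality.

Set Implicit Arguments.
Unset Strict Implicit.
Unset Printing Implicit Defensive.

Local Open Scope classical_set_scope.
Local Open Scope quotient_scope.

(** * Groups *)

Definition isomorphic (G H : groupType) :=
  exists f : {multiplicative G -> H}, bijective f.

(** A group given by representatives: operations on a type satisfying the
    group laws up to a congruence. Its quotient is a group. *)
Record pregroup := Pregroup {
  pcarrier :> choiceType;
  peq : pcarrier -> pcarrier -> Prop;
  pone : pcarrier;
  pinv : pcarrier -> pcarrier;
  pmul : pcarrier -> pcarrier -> pcarrier;
  peq_refl : forall x, peq x x;
  peq_sym : forall x y, peq x y -> peq y x;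
  peq_trans : forall y x z, peq x y -> peq y z -> peq x z;
  pmul_cong : forall x x' y y', peq x x' -> peq y y' ->
    peq (pmul x y) (pmul x' y');
  pmulA : forall x y z, peq (pmul x (pmul y z)) (pmul (pmul x y) z);
  pmul1 : forall x, peq (pmul pone x) x;
  pmulV : forall x, peq (pmul (pinv x) x) pone
}.

Section GroupOf.
Variable P : pregroup.

Definition peqb (x y : P) : bool := `[< peq x y >].

Fact peqb_refl : reflexive peqb.
Proof. by move=> x; apply/asboolP/peq_refl. Qed.

Fact peqb_sym : symmetric peqb.
Proof. by move=> x y; apply: asbool_equiv_eq; split; apply: peq_sym. Qed.

Fact peqb_trans : transitive peqb.
Proof.
by move=> y x z /asboolP xy /asboolP yz; apply/asboolP/(peq_trans xy yz).
Qed.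

Definition peq_equiv : equiv_rel P := EquivRel peqb peqb_refl peqb_sym peqb_trans.

Definition group_of : Type := {eq_quot peq_equiv}.
HB.instance Definition _ := Choice.on group_of.

Definition class_of (x : P) : group_of := (\pi_{eq_quot peq_equiv} x)%qT.

Lemma class_of_eqP (x y : P) : class_of x = class_of y <-> peq x y.
Proof.
split=> [/eqP|xy]; first by rewrite /class_of eqmodE => /asboolP.
by apply/eqP; rewrite /class_of eqmodE; apply/asboolP.
Qed.

Lemma class_of_surj (x : group_of) : exists y, x = class_of y.
Proof. by exists (repr (x : {eq_quot peq_equiv})); rewrite /class_of reprK. Qed.

Definition rep (x : group_of) : P := repr (x : {eq_quot peq_equiv}).

Lemma repK x : class_of (rep x) = x.
Proof. by rewrite /class_of /rep reprK. Qed.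

Lemma rep_class x : peq (rep (class_of x)) x.
Proof. by apply/class_of_eqP; rewrite repK. Qed.

Let gmul (x y : group_of) := class_of (pmul (rep x) (rep y)).
Let gone := class_of (pone P).
Let ginv (x : group_of) := class_of (pinv (rep x)).

Let gmulE x y : gmul (class_of x) (class_of y) = class_of (pmul x y).
Proof. by apply/class_of_eqP/pmul_cong; apply: rep_class. Qed.

Let gmulA : associative gmul.
Proof.
move=> x y z; have [[x' ->] [y' ->] [z' ->]] :=
  And3 (class_of_surj x) (class_of_surj y) (class_of_surj z).
by rewrite !gmulE; apply/class_of_eqP/pmulA.
Qed.

Let gmul1g : left_id gone gmul.
Proof.
move=> x; have [x' ->] := class_of_surj x.
by rewrite gmulE; apply/class_of_eqP/pmul1.
Qed.

Let gmulVg : left_inverse gone ginv gmul.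
Proof. by move=> x; rewrite -{2}[x]repK gmulE; apply/class_of_eqP/pmulV. Qed.

Let gmulgV : right_inverse gone ginv gmul.
Proof.
move=> x; rewrite -[LHS]gmul1g -{1}[gone](gmulVg (ginv x)) -gmulA.
by rewrite [X in gmul _ X]gmulA gmulVg gmul1g gmulVg.
Qed.

Let gmulg1 : right_id gone gmul.
Proof. by move=> x; rewrite -[in LHS](gmulVg x) gmulA gmulgV gmul1g. Qed.

HB.instance Definition _ :=
  isGroup.Build group_of gmulA gmul1g gmulg1 gmulVg gmulgV.

Lemma class_of1 : class_of (pone P) = 1%g.
Proof. by []. Qed.

Lemma class_ofM x y : class_of (pmul x y) = (class_of x * class_of y)%g.
Proof. exact/esym/gmulE. Qed.

Lemma class_ofV x : class_of (pinv x) = (class_of x)^-1%g.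
Proof.
apply: (mulIg (class_of x)); rewrite mulVg -class_ofM.
exact/class_of_eqP/pmulV.
Qed.

End GroupOf.

(** ** Subgroups, quotients and torsion *)

Definition subgroup (G : groupType) : set (set G) := [set H |
  [/\ H 1%g, forall x y, H x -> H y -> H (x * y)%g &
      forall x, H x -> H x^-1%g]].

Record nsubgroup (G : groupType) := NSubgroup {
  nset :> set G;
  nsubP : subgroup nset;
  nconj : forall x y, nset x -> nset (x ^ y)%g
}.

Section Quotient.
Variables (G : groupType) (N : nsubgroup G).
Local Open Scope group_scope.

Definition coset_eq (x y : G) := nset N (x^-1 * y).

Fact coset_eq_refl x : coset_eq x x.
Proof. by rewrite /coset_eq mulVg; have [] := nsubP N. Qed.

Fact coset_eq_sym x y : coset_eq x y -> coset_eq y x.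
Proof.
have [_ _ NV] := nsubP N.
by move=> /NV; rewrite /coset_eq invgM invgK.
Qed.

Fact coset_eq_trans y x z : coset_eq x y -> coset_eq y z -> coset_eq x z.
Proof.
have [_ NM _] := nsubP N.
by move=> xy yz; have := NM _ _ xy yz; rewrite /coset_eq mulgA mulgK.
Qed.

Fact coset_eq_mul x x' y y' :
  coset_eq x x' -> coset_eq y y' -> coset_eq (x * y) (x' * y').
Proof.
have [_ NM _] := nsubP N; move=> /(@nconj _ N _ y) xx' yy'.
have := NM _ _ xx' yy'; rewrite /coset_eq /conjg invgM.
by rewrite !mulgA mulgK.
Qed.

Fact coset_mulA (x y z : G) : coset_eq (x * (y * z)) (x * y * z).
Proof. by rewrite mulgA; apply: coset_eq_refl. Qed.

Fact coset_mul1 (x : G) : coset_eq (1 * x) x.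
Proof. by rewrite mul1g; apply: coset_eq_refl. Qed.

Fact coset_mulV (x : G) : coset_eq (x^-1 * x) 1.
Proof. by rewrite mulVg; apply: coset_eq_refl. Qed.

Definition quotient_pregroup : pregroup :=
  Pregroup coset_eq_refl coset_eq_sym coset_eq_trans coset_eq_mul
    coset_mulA coset_mul1 coset_mulV.

Definition quotient : groupType := group_of quotient_pregroup.

End Quotient.

Definition finite_order (G : groupType) (x : G) : Prop :=
  exists2 n, 0 < n & (x ^+ n = 1)%g.

(** [smallest subgroup A] is the intersection of all subgroups containing [A]. *)
Definition torsion_set (G : groupType) : set G :=
  smallest (@subgroup G) (@finite_order G).

Fact torsion_subgroup (G : groupType) : subgroup (@torsion_set G).
Proof.
split=> [H [] []//|x y tx ty H HT|x tx H HT].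
- by have [[_ + _] _] := HT; apply; [apply: tx|apply: ty].
- by have [[_ _ +] _] := HT; apply; apply: tx.
Qed.

Fact torsion_conj (G : groupType) (x y : G) :
  torsion_set x -> torsion_set (x ^ y)%g.
Proof.
move=> tx H [[H1 HM HV] HT].
apply: (tx [set z | H (z ^ y)%g]); split=> [|z [n n0 zn]]; last first.
  by apply: HT; exists n; rewrite // -conjXg zn conj1g.
split=> [|u v Hu Hv|u Hu] /=; first by rewrite conj1g.
- by rewrite conjMg; apply: HM.
- by rewrite conjVg; apply: HV.
Qed.

Definition Tor (G : groupType) : nsubgroup G :=
  NSubgroup (@torsion_subgroup G) (@torsion_conj G).

Definition torsion_free_set (G : groupType) (H : set G) :=
  forall x, H x -> finite_order x -> x = 1%g.

Definition finite_index (G : groupType) (H : set G) :=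
  finite_set (range (fun x : G => [set (x * h)%g | h in H])).

Definition virtually_torsion_free (G : groupType) :=
  exists H : set G, [/\ subgroup H, torsion_free_set H & finite_index H].

(** ** Semidirect products *)

Record gaction (Q N : groupType) := GAction {
  gact :> Q -> N -> N;
  gact1 : forall x, gact 1%g x = x;
  gactM : forall g h x, gact (g * h)%g x = gact g (gact h x);
  gact_morph : forall g, {morph gact g : x y / (x * y)%g}
}.

(** The underlying type does not depend on the action, the group law does. *)
Definition sdprod (Q N : groupType) (a : gaction Q N) : Type := (N * Q)%type.

Section SemidirectProduct.
Variables (Q N : groupType) (a : gaction Q N).
Local Open Scope group_scope.

HB.instance Definition _ := Choice.copy (sdprod a) (N * Q)%type.

Let sone : sdprod a := (1, 1).
Let smul (u v : sdprod a) : sdprod a := (u.1 * a u.2 v.1, u.2 * v.2).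
Let sinv (u : sdprod a) : sdprod a := (a u.2^-1 u.1^-1, u.2^-1).

Let gact_one g : a g 1 = 1.
Proof. by apply: (mulgI (a g 1)); rewrite -gact_morph !mulg1. Qed.

Let smulA : associative smul.
Proof. by move=> u v w; rewrite /smul /= gact_morph gactM !mulgA. Qed.

Let smul1 : left_id sone smul.
Proof. by case=> x g; rewrite /smul /= gact1 !mul1g. Qed.

Let smulr1 : right_id sone smul.
Proof. by case=> x g; rewrite /smul /= gact_one !mulg1. Qed.

Let smulV : left_inverse sone sinv smul.
Proof.
by case=> x g; rewrite /smul /= -gact_morph !mulVg gact_one.
Qed.

Let smulrV : right_inverse sone sinv smul.
Proof. by case=> x g; rewrite /smul /= -gactM mulgV gact1 mulgV. Qed.

HB.instance Definition _ :=
  isGroup.Build (sdprod a) smulA smul1 smulr1 smulV smulrV.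

End SemidirectProduct.

(** ** Presentations *)

(** The letter [(x, true)] stands for [x] and [(x, false)] for its inverse. *)
Definition word (X : Type) := seq (X * bool).

Definition winv (X : Type) (w : word X) : word X :=
  rev [seq (a.1, ~~ a.2) | a <- w].

Section Presentation.
Variables (X : choiceType) (R : set (word X)).

Inductive pres_eq : word X -> word X -> Prop :=
| pres_refl w : pres_eq w w
| pres_sym w w' : pres_eq w w' -> pres_eq w' w
| pres_trans w' w w'' : pres_eq w w' -> pres_eq w' w'' -> pres_eq w w''
| pres_cancel u x b v : pres_eq (u ++ [:: (x, b); (x, ~~ b)] ++ v) (u ++ v)
| pres_relator u r v : R r -> pres_eq (u ++ r ++ v) (u ++ v).

Fact pres_cat s t w w' : pres_eq w w' -> pres_eq (s ++ w ++ t) (s ++ w' ++ t).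
Proof.
elim=> [v|v v' _|v v' v'' _ + _|u x b v|u r v Rr].
- exact: pres_refl.
- exact: pres_sym.
- exact: pres_trans.
- by have := pres_cancel (s ++ u) x b (v ++ t); rewrite -!catA.
- by have := pres_relator (s ++ u) (v ++ t) Rr; rewrite -!catA.
Qed.

Fact pres_cong w w' v v' :
  pres_eq w w' -> pres_eq v v' -> pres_eq (w ++ v) (w' ++ v').
Proof.
move=> /(@pres_cat [::] v) ww' /(@pres_cat w' [::]) vv'.
by apply: pres_trans ww' _; rewrite /= !cats0 in vv' *.
Qed.

Fact pres_catA (u v w : word X) : pres_eq (u ++ v ++ w) ((u ++ v) ++ w).
Proof. by rewrite catA; apply: pres_refl. Qed.

Fact pres_cat0 (w : word X) : pres_eq ([::] ++ w) w.
Proof. exact: pres_refl. Qed.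

Fact pres_catV (w : word X) : pres_eq (winv w ++ w) [::].
Proof.
elim: w => [|[x b] w IHw]; first exact: pres_refl.
rewrite /winv /= rev_cons cat_rcons; apply: pres_trans IHw.
by have := pres_cancel (winv w) x (~~ b) w; rewrite negbK.
Qed.

Definition pres_pregroup : pregroup :=
  Pregroup pres_refl pres_sym pres_trans pres_cong pres_catA pres_cat0 pres_catV.

Definition pres : groupType := group_of pres_pregroup.

End Presentation.

Definition finitely_presented (G : groupType) :=
  exists n (R : set (word 'I_n)), finite_set R /\ isomorphic (pres R) G.

(** * Recursively enumerable sets *)

(** Kleene's partial recursive functions. Arities are not tracked: a missing
    argument of [RProj] reads as [0], that of [RSucc] likewise. *)
Inductive recfun :=
| RZero
| RSucc
| RProj of nat
| RComp of recfun & seq recfun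
| RPrim of recfun & recfun
| RMu of recfun.

(** [rec_eval f xs y]: the function [f] is defined at [xs], with value [y]. *)
Fixpoint rec_eval (f : recfun) (xs : seq nat) (y : nat) {struct f} : Prop :=
  match f with
  | RZero => y = 0
  | RSucc => y = (head 0 xs).+1
  | RProj i => y = nth 0 xs i
  | RComp g hs =>
      exists2 ys, rec_eval g ys y &
        (fix evals (hs : seq recfun) (ys : seq nat) : Prop :=
           match hs, ys with
           | [::], [::] => True
           | h :: hs', z :: ys' => rec_eval h xs z /\ evals hs' ys'
           | _, _ => False
           end) hs ys
  | RPrim g h =>
      if xs is n :: xs' then
        (fix loop (n : nat) (y : nat) : Prop :=
           match n with
           | 0 => rec_eval g xs' y
           | m.+1 => exists2 z, loop m z & rec_eval h [:: m, z & xs'] y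
           end) n y
      else False
  | RMu g =>
      rec_eval g (y :: xs) 0 /\
      (forall z, z < y -> exists v, rec_eval g (z :: xs) v.+1)
  end.

Definition recursively_enumerable (S : set nat) :=
  exists f : recfun, forall x, S x <-> exists y, rec_eval f [:: x] y.

(** Goedel number of a word in [n] generators and their inverses: bijective
    base-[2n] notation, the letters being the digits [1, ..., 2n]. *)
Definition word_code n (w : word 'I_n) : nat :=
  foldr (fun (a : 'I_n * bool) c => (2 * a.1 + a.2).+1 + 2 * n * c) 0 w.

Lemma word_code_inj n : injective (@word_code n).
Proof.
elim=> [|[i b] w IHw] [|[j c] v] //=.
have lt (k : 'I_n) (d : bool) : 2 * k + d < 2 * n.
  have kn := ltn_ord k; apply: (@leq_trans (2 * k.+1)); last by rewrite leq_mul2l.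
  by rewrite mulnS addnC ltn_add2r; case: d.
rewrite !addSn => -[e].
have := congr1 (modn^~ (2 * n)) e; have := congr1 (divn^~ (2 * n)) e.
have n0 : 0 < 2 * n by apply: leq_ltn_trans (lt i b).
rewrite !(mulnC (2 * n)) !divnDMl // !(divn_small (lt _ _)) !add0n.
rewrite !(addnC _ (_ * _)) !modnMDl !(modn_small (lt _ _)) => /IHw -> eij.
have eb : b = c.
  by have := congr1 odd eij; rewrite !mul2n !oddD !odd_double !oddb.
have ei : i = j.
  apply: val_inj; apply/eqP; rewrite -(eqn_pmul2l (ltn0Sn 1)).
  by rewrite -(eqn_add2r b) {2}eb eij.
by rewrite eb ei.
Qed.

Definition recursively_presented (G : groupType) :=
  exists n (R : set (word 'I_n)),
    recursively_enumerable [set word_code w | w in R] /\ isomorphic (pres R) G.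

(** * Simplicial complexes *)

Record scomplex := SComplex {
  vertex :> choiceType;
  simplex : set {fset vertex};
  simplex_neq0 : forall s, simplex s -> s != fset0;
  simplex1 : forall v, simplex [fset v]%fset;
  simplexS : forall s t, (t `<=` s)%fset -> t != fset0 -> simplex s -> simplex t
}.

Definition adjacent (L : scomplex) (u v : L) :=
  u <> v /\ simplex [fset u; v]%fset.

Definition flag (L : scomplex) :=
  forall s : {fset L}, s != fset0 ->
    {in s &, forall u v, u <> v -> adjacent u v} -> simplex s.

Definition simplicial (K L : scomplex) (f : K -> L) :=
  forall s : {fset K}, simplex s -> simplex [fset f x | x in s]%fset.

(** ** Edge paths *)

(** [edge_path x s]: the list [x :: s] of vertices is an edge path (which may
    stay at a vertex). It ends at [last x s]. *)
Fixpoint edge_path (L : scomplex) (x : L) (s : seq L) : Prop :=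
  if s is y :: s' then simplex [fset x; y]%fset /\ edge_path y s' else True.

Definition connected (L : scomplex) :=
  (exists x : L, True) /\
  forall x y : L, exists2 s, edge_path x s & last x s = y.

Section EdgePathGroup.
Variables (L : scomplex) (x0 : L).

(** Edge homotopy of the paths [x0 :: s] and [x0 :: t]: a constant edge may be
    removed, and [u, v, w] replaced by [u, w] if they span a simplex. *)
Inductive homotopic : seq L -> seq L -> Prop :=
| homotopic_refl s : homotopic s s
| homotopic_sym s t : homotopic s t -> homotopic t s
| homotopic_trans t s r : homotopic s t -> homotopic t r -> homotopic s r
| homotopic_const s t : homotopic (s ++ last x0 s :: t) (s ++ t)
| homotopic_triangle s v w t :
    simplex [fset last x0 s; v; w]%fset ->
    homotopic (s ++ [:: v, w & t]) (s ++ w :: t).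

Definition loopb (s : seq L) : bool := `[< edge_path x0 s /\ last x0 s = x0 >].

Definition loop : Type := {s : seq L | loopb s}.
HB.instance Definition _ := Choice.on loop.

End EdgePathGroup.

Section EdgePathTheory.
Variable L : scomplex.
Implicit Types (x y : L) (s t r : seq L).

Lemma edge_path_cat x s t :
  edge_path x (s ++ t) <-> edge_path x s /\ edge_path (last x s) t.
Proof.
elim: s x => [|y s IHs] x /=; first by split=> [|[]].
by rewrite IHs; tauto.
Qed.

Lemma edge_path_rev x s :
  edge_path x s -> edge_path (last x s) (rev (belast x s)).
Proof.
elim: s x => [|y s IHs] x //= [xy ys].
rewrite rev_cons -cats1; apply/edge_path_cat; split; first exact: IHs.
suff -> : last (last y s) (rev (belast y s)) = y by rewrite /= fsetUC.
by case: s {IHs ys} => //= z s; rewrite rev_cons last_rcons.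
Qed.

Lemma last_rev_belast x s : last (last x s) (rev (belast x s)) = x.
Proof. by case: s => //= z s; rewrite rev_cons last_rcons. Qed.

Lemma rev_belastK x s : rev (belast (last x s) (rev (belast x s))) = s.
Proof.
rewrite -[RHS]revK; congr rev.
set y := last x s; set r := rev (belast x s).
have : rcons (belast y r) (last y r) = rcons (rev s) x.
  by rewrite -lastI -rev_cons [x :: s]lastI rev_rcons.
by rewrite last_rev_belast => /rcons_inj[].
Qed.

Lemma homotopic_last x s t : homotopic x s t -> last x s = last x t.
Proof.
elim=> [//|//|? ? ? _ -> _ -> //|s' t'|s' v w t' _]; rewrite !last_cat //=.
Qed.

Lemma homotopic_cat x s s' t :
  homotopic x s s' -> homotopic x (s ++ t) (s' ++ t).
Proof.
elim=> [v|v v' _|v v' v'' _ + _|u v|u v w r uvw].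
- exact: homotopic_refl.
- exact: homotopic_sym.
- exact: homotopic_trans.
- by rewrite -!catA; apply: homotopic_const.
- by rewrite -!catA; apply: homotopic_triangle.
Qed.

Lemma cat_homotopic x s t t' :
  homotopic (last x s) t t' -> homotopic x (s ++ t) (s ++ t').
Proof.
elim=> [v|v v' _|v v' v'' _ + _|u v|u v w r uvw].
- exact: homotopic_refl.
- exact: homotopic_sym.
- exact: homotopic_trans.
- by rewrite !catA -last_cat; apply: homotopic_const.
- by rewrite !catA; apply: homotopic_triangle; rewrite last_cat.
Qed.

Lemma homotopic_rev x s :
  edge_path x s -> homotopic x (s ++ rev (belast x s)) [::].
Proof.
elim: s x => [|y s IHs] x /= => [_|[xy ys]]; first exact: homotopic_refl.
rewrite rev_cons -cats1 catA.
have /(homotopic_cat [:: x]) : homotopic x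
    ([:: y] ++ (s ++ rev (belast y s))) ([:: y] ++ [::]).
  exact/cat_homotopic/IHs.
move=> h; apply: homotopic_trans h _.
have xyx : simplex [fset last x [::]; y; x]%fset.
  suff -> : [fset last x [::]; y; x]%fset = [fset x; y]%fset by [].
  by apply/fsetP => z; rewrite !inE /=; case: (z == x); rewrite ?orbT ?orbF.
apply: homotopic_trans (homotopic_triangle [::] xyx) _.
exact: (homotopic_const x [::] [::]).
Qed.

End EdgePathTheory.

Section FundamentalGroup.
Variables (L : scomplex) (x0 : L).

Let loopP (s : loop x0) : edge_path x0 (val s) /\ last x0 (val s) = x0.
Proof. exact/asboolP/(valP s). Qed.

Definition loop_eq (s t : loop x0) := homotopic x0 (val s) (val t).

Fact loop1_subproof : loopb x0 [::].
Proof. exact/asboolP. Qed.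

Definition loop1 : loop x0 := Sub [::] loop1_subproof.

Fact loopM_subproof (s t : loop x0) : loopb x0 (val s ++ val t).
Proof.
have [[ps ls] [pt lt]] := (loopP s, loopP t).
by apply/asboolP; rewrite edge_path_cat last_cat ls.
Qed.

Definition loopM (s t : loop x0) : loop x0 :=
  Sub (val s ++ val t) (loopM_subproof s t).

Fact loopV_subproof (s : loop x0) : loopb x0 (rev (belast x0 (val s))).
Proof.
have [ps ls] := loopP s; apply/asboolP.
move: (val s) ps ls => r pr lr; have := last_rev_belast x0 r.
by have := edge_path_rev pr; rewrite lr.
Qed.

Definition loopV (s : loop x0) : loop x0 :=
  Sub (rev (belast x0 (val s))) (loopV_subproof s).

Fact loop_eq_refl s : loop_eq s s.
Proof. exact: homotopic_refl. Qed.

Fact loop_eq_sym s t : loop_eq s t -> loop_eq t s.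
Proof. exact: homotopic_sym. Qed.

Fact loop_eq_trans t s r : loop_eq s t -> loop_eq t r -> loop_eq s r.
Proof. exact: homotopic_trans. Qed.

Fact loop_eqM s s' t t' :
  loop_eq s s' -> loop_eq t t' -> loop_eq (loopM s t) (loopM s' t').
Proof.
move=> ss' tt'; apply: homotopic_trans (homotopic_cat _ ss') _ => /=.
by apply: cat_homotopic; rewrite (loopP s').2.
Qed.

Fact loopMA s t r : loop_eq (loopM s (loopM t r)) (loopM (loopM s t) r).
Proof. by rewrite /loop_eq /= catA; apply: homotopic_refl. Qed.

Fact loopM1 s : loop_eq (loopM loop1 s) s.
Proof. exact: homotopic_refl. Qed.

Fact loopMV s : loop_eq (loopM (loopV s) s) loop1.
Proof.
have [pV lV] := loopP (loopV s); have := homotopic_rev pV.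
suff -> : rev (belast x0 (val (loopV s))) = val s by [].
by have := rev_belastK x0 (val s); rewrite (loopP s).2.
Qed.

(** The fundamental group of [L] at [x0]: edge loops up to homotopy. *)
Definition pi1_pregroup : pregroup :=
  Pregroup loop_eq_refl loop_eq_sym loop_eq_trans loop_eqM loopMA loopM1 loopMV.

Definition pi1 : groupType := group_of pi1_pregroup.

Definition pi1_class (s : loop x0) : pi1 := class_of (P := pi1_pregroup) s.

End FundamentalGroup.

(** ** Coverings *)

Definition simply_connected (L : scomplex) :=
  connected L /\ forall (x : L) (g : pi1 x), g = 1%g.

(** A simplicial map is a covering when it is onto and maps the simplices
    containing any given vertex bijectively onto the simplices containing its
    image; it is then injective on every simplex [s], since two vertices [x], [y]
    of [s] with the same image [v] would give two simplices [[fset x]] and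
    [[fset x; y]] containing [x] with image [[fset v]]. *)
Definition covering (K L : scomplex) (p : K -> L) :=
  [/\ simplicial p, set_surj [set: K] [set: L] p &
      forall x : K, set_bij [set s | simplex s /\ x \in s]
                            [set t | simplex t /\ p x \in t]
                            (fun s => [fset p y | y in s]%fset)].

Definition universal_cover (K L : scomplex) (p : K -> L) :=
  covering p /\ simply_connected K.

(** The action of the fundamental group of the base by deck transformations,
    normalised at [k0]: the class of a loop sends [k0] to the end of the lift of
    this loop starting at [k0]. *)
Record deck_action (K L : scomplex) (p : K -> L) (k0 : K) := DeckAction {
  dact :> pi1 (p k0) -> K -> K;
  dact1 : forall x, dact 1%g x = x;
  dactM : forall g h x, dact (g * h)%g x = dact g (dact h x);
  dact_simplicial : forall g, simplicial (dact g);
  dact_cover : forall g x, p (dact g x) = p x;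
  dact_lift : forall (s : loop (p k0)) (t : seq K),
    edge_path k0 t -> map p t = val s -> dact (pi1_class s) k0 = last k0 t
}.

(** The deck action of a universal cover exists. *)
Section Lifting.
Variables (K L : scomplex) (p : K -> L).
Hypothesis p_cov : covering p.

Lemma lift_simplex (x : K) (t : {fset L}) : simplex t -> p x \in t ->
  exists s : {fset K}, [/\ simplex s, x \in s & [fset p y | y in s]%fset = t].
Proof.
have [_ _ /(_ x) [_ _ surj]] := p_cov.
by move=> tL xt; have [|s [sK xs] <-] := surj t; [by split | by exists s].
Qed.

Lemma lift_edge (x : K) (v : L) : simplex [fset p x; v]%fset ->
  exists2 y, simplex [fset x; y]%fset & p y = v.
Proof.
move=> xv; have [|s [sK xs es]] := @lift_simplex x _ xv; first by rewrite !inE eqxx.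
have : v \in [fset p y | y in s]%fset by rewrite es !inE eqxx orbT.
move=> /imfsetP[y /= ys ->]; exists y => //.
apply: simplexS sK; first by rewrite fsubUset !fsub1set xs.
by apply/fset0Pn; exists x; rewrite !inE eqxx.
Qed.

Lemma lift_edge_uniq (x y y' : K) :
  simplex [fset x; y]%fset -> simplex [fset x; y']%fset -> p y = p y' -> y = y'.
Proof.
have [_ _ /(_ x) [_ inj _]] := p_cov.
move=> xy xy' pyy'; have : [fset x; y]%fset = [fset x; y']%fset.
  by apply: inj; rewrite ?inE /= ?inE ?eqxx // !imfsetU !imfset_fset1 pyy'.
move=> /fsetP e; have := e y; have := e y'; rewrite !inE !eqxx !orbT.
by move=> /orP[/eqP->|/eqP//] /esym /orP[]/eqP.
Qed.

Lemma lift_path (x : K) (s : seq L) : edge_path (p x) s ->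
  exists2 t, edge_path x t & map p t = s.
Proof.
elim: s x => [|v s IHs] x /=; first by exists [::].
move=> [/lift_edge[y xy <-] /IHs[t yt <-]]; by exists (y :: t).
Qed.

Lemma lift_path_uniq (x : K) (t t' : seq K) :
  edge_path x t -> edge_path x t' -> map p t = map p t' -> t = t'.
Proof.
elim: t t' x => [|y t IHt] [|y' t'] x //= [xy yt] [xy' yt'] [pyy' ptt'].
have eyy' := lift_edge_uniq xy xy' pyy'; rewrite -eyy' in yt' *.
by rewrite (IHt t' y).
Qed.

Lemma map_eq_cat (t : seq K) (a b : seq L) : map p t = a ++ b ->
  exists t1 t2, [/\ t = t1 ++ t2, map p t1 = a & map p t2 = b].
Proof.
move=> e; exists (take (size a) t), (drop (size a) t).
by rewrite cat_take_drop map_take map_drop e take_size_cat // drop_size_cat.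
Qed.

Let lifts_to x s s' := forall t, edge_path x t -> map p t = s ->
  exists t', [/\ edge_path x t', map p t' = s' & last x t' = last x t].

Lemma lift_homotopic x s s' :
  homotopic (p x) s s' -> lifts_to x s s' /\ lifts_to x s' s.
Proof.
elim=> [r|r r' _ []//|r r' r'' _ [rr' r'r] _ [r'r'' r''r']|a b|a v w b uvw].
- by split=> t; exists t.
- split=> t.
    by move=> xt /(rr' _ xt) [t' [xt' /(r'r'' _ xt') [t'' [? ? <-]] <-]]; exists t''.
  by move=> xt /(r''r' _ xt) [t' [xt' /(r'r _ xt') [t'' [? ? <-]] <-]]; exists t''.
- split=> t xt /map_eq_cat [t1 [t2 [et <-]]].
    case: t2 et => [//|y t2] et [py <-]; move: xt; rewrite et.
    rewrite edge_path_cat /= => -[xt1 [zy yt2]].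
    have ey : y = last x t1.
      apply: (@lift_edge_uniq (last x t1)) => //; last by rewrite py last_map.
      by rewrite fsetUid; apply: simplex1.
    exists (t1 ++ t2); rewrite map_cat !last_cat /= ey; split=> //.
    by apply/edge_path_cat; split=> //; rewrite -ey.
  move=> <-; exists (t1 ++ last x t1 :: t2).
  move: xt; rewrite et edge_path_cat map_cat !last_cat /= last_map => -[? ?].
  split=> //; apply/edge_path_cat; split=> //=; split=> //.
  by rewrite fsetUid; apply: simplex1.
- have lift_triangle t1 : map p t1 = a -> exists y1 y2, [/\ p y1 = v, p y2 = w,
      simplex [fset last x t1; y1]%fset, simplex [fset last x t1; y2]%fset &
      simplex [fset y1; y2]%fset].
    move=> et1; move: uvw; rewrite -et1 last_map => uvw.
    have [|s0 [sK zs es]] := @lift_simplex (last x t1) _ uvw; first by rewrite !inE eqxx.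
    have /imfsetP[y1 /= y1s ev] : v \in [fset p y | y in s0]%fset.
      by rewrite es !inE eqxx orbT.
    have /imfsetP[y2 /= y2s ew] : w \in [fset p y | y in s0]%fset.
      by rewrite es !inE eqxx orbT.
    have sub c d : c \in s0 -> d \in s0 -> simplex [fset c; d]%fset.
      move=> cs ds; apply: simplexS sK; first by rewrite fsubUset !fsub1set cs.
      by apply/fset0Pn; exists c; rewrite !inE eqxx.
    by exists y1, y2; split=> //; apply: sub.
  split=> t xt /map_eq_cat [t1 [t2 [et et1]]];
    have [y1 [y2 [ev ew zy1 zy2 y12]]] := lift_triangle _ et1.
    case: t2 et => [//|z1 [//|z2 t2]] et [ez1 ez2 <-]; move: xt; rewrite et.
    rewrite edge_path_cat /= => -[xt1 [zz1 [z12 zt2]]].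
    have ez1' : z1 = y1 by apply: lift_edge_uniq zz1 zy1 _; rewrite ev.
    have ez2' : z2 = y2.
      by rewrite ez1' in z12; apply: lift_edge_uniq z12 y12 _; rewrite ew.
    exists (t1 ++ z2 :: t2); rewrite map_cat !last_cat /= et1 ez2.
    by split=> //; apply/edge_path_cat; split=> //=; split=> //; rewrite ez2'.
  case: t2 et => [//|z2 t2] et [ez2 <-]; move: xt; rewrite et.
  rewrite edge_path_cat /= => -[xt1 [zz2 zt2]].
  have ez2' : z2 = y2 by apply: lift_edge_uniq zz2 zy2 _; rewrite ew.
  exists (t1 ++ [:: y1, z2 & t2]).
  rewrite map_cat !last_cat /= et1 ez2 ev; split=> //.
  by apply/edge_path_cat; split=> //=; rewrite ez2' in zt2 *.
Qed.

Lemma lift_homotopic_last x s s' t t' : homotopic (p x) s s' ->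
  edge_path x t -> map p t = s -> edge_path x t' -> map p t' = s' ->
  last x t = last x t'.
Proof.
move=> /lift_homotopic [+ _] xt et xt' et' => /(_ _ xt et) [r [xr er <-]].
by rewrite (lift_path_uniq xr xt') // er et'.
Qed.

Lemma map_homotopic x s s' :
  homotopic x s s' -> homotopic (p x) (map p s) (map p s').
Proof.
have [p_simp _ _] := p_cov.
elim=> [r|r r' _|r r' r'' _ + _|a b|a v w b uvw].
- exact: homotopic_refl.
- exact: homotopic_sym.
- exact: homotopic_trans.
- by rewrite !map_cat /= -last_map; apply: homotopic_const.
- rewrite !map_cat /=; apply: homotopic_triangle; rewrite last_map.
  by have := p_simp _ uvw; rewrite !imfsetU !imfset_fset1.
Qed.

Lemma edge_path_map x s : edge_path x s -> edge_path (p x) (map p s).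
Proof.
have [p_simp _ _] := p_cov.
elim: s x => //= y s IHs x [xy /IHs ?]; split=> //.
by have := p_simp _ xy; rewrite !imfsetU !imfset_fset1.
Qed.

Hypothesis K_sc : simply_connected K.

Lemma simply_connected_homotopic x (t t' : seq K) :
  edge_path x t -> edge_path x t' -> last x t = last x t' -> homotopic x t t'.
Proof.
move=> xt xt' ett'; set r := rev (belast x t').
have yr : edge_path (last x t) r by rewrite ett'; apply: edge_path_rev.
have lr : last (last x t) r = x by rewrite ett' last_rev_belast.
have tr : loopb x (t ++ r).
  by apply/asboolP; rewrite edge_path_cat last_cat.
have h : homotopic x (t ++ r) [::].
  have := K_sc.2 x (pi1_class (Sub (t ++ r) tr)).
  by rewrite -class_of1 => /class_of_eqP.
apply: homotopic_trans (_ : homotopic x (t ++ (r ++ t')) t').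
  rewrite -[t in X in homotopic x X _]cats0.
  apply: cat_homotopic; apply: homotopic_sym.
  have := homotopic_rev yr; suff -> : rev (belast (last x t) r) = t' by [].
  by rewrite ett' rev_belastK.
by rewrite catA; apply: (homotopic_cat _ h).
Qed.

Variable k0 : K.

Let path_to (x : K) : {t | edge_path k0 t /\ last k0 t = x}.
Proof.
by apply: cid; have [t] := K_sc.1.2 k0 x; exists t.
Qed.

Let lift (s : seq L) (sP : edge_path (p k0) s) :
  {t | edge_path k0 t /\ map p t = s}.
Proof. by apply: cid; have [t] := lift_path sP; exists t. Qed.

Let loop_path (s : loop (p k0)) t :
  edge_path k0 t -> edge_path (p k0) (val s ++ map p t).
Proof.
have /asboolP [ps ls] := valP s => k0t; rewrite edge_path_cat.
by rewrite ls; split=> //; apply: edge_path_map.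
Qed.

Let deck (g : pi1 (p k0)) (x : K) : K :=
  last k0 (sval (lift (loop_path (rep g) (svalP (path_to x)).1))).

Let deckE (s : loop (p k0)) t r : edge_path k0 t -> edge_path k0 r ->
  map p r = val s ++ map p t -> deck (pi1_class s) (last k0 t) = last k0 r.
Proof.
move=> k0t k0r er; rewrite /deck; set lt := lift _.
have [k0q eq] := svalP lt; have [k0u eu] := svalP (path_to (last k0 t)).
apply: lift_homotopic_last k0q eq k0r er.
apply: homotopic_trans (homotopic_cat _ _) _.
  exact: (@rep_class (pi1_pregroup (p k0))).
apply: cat_homotopic; have /asboolP [_ ->] := valP s.
exact/map_homotopic/simply_connected_homotopic.
Qed.

Let deckP (s : loop (p k0)) x : exists t r,
  [/\ edge_path k0 t, last k0 t = x, edge_path k0 r,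
      map p r = val s ++ map p t & deck (pi1_class s) x = last k0 r].
Proof.
have [t [k0t et]] := path_to x; have [r [k0r er]] := lift (loop_path s k0t).
by exists t, r; split=> //; rewrite -et; apply: deckE.
Qed.

Let pi1_surj (g : pi1 (p k0)) : exists s, g = pi1_class s.
Proof. exact: (@class_of_surj (pi1_pregroup (p k0))). Qed.

Let deck1 x : deck 1%g x = x.
Proof.
have [t [k0t <-]] := path_to x.
exact: (@deckE (loop1 (p k0)) t t).
Qed.

Let deckM g h x : deck (g * h)%g x = deck g (deck h x).
Proof.
have [[s ->] [s' ->]] := (pi1_surj g, pi1_surj h).
have [t [r [k0t <- k0r er ->]]] := deckP s' x.
have [q [k0q eq]] := lift (loop_path s k0r).
rewrite (deckE k0r k0q eq) -class_ofM.
by apply: (@deckE (loopM s s')) => //; rewrite eq er /= catA.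
Qed.

Let deck_cover g x : p (deck g x) = p x.
Proof.
have [s ->] := pi1_surj g; have [t [r [k0t <- k0r er ->]]] := deckP s x.
have /asboolP [_ ls] := valP s.
by have := congr1 (last (p k0)) er; rewrite last_cat ls !last_map.
Qed.

Let deck_edge g x y : simplex [fset x; y]%fset ->
  simplex [fset deck g x; deck g y]%fset.
Proof.
have [s ->] := pi1_surj g; have [t [r [k0t <- k0r er ->]]] := deckP s x.
move=> xy; have k0ty : edge_path k0 (t ++ [:: y]) by rewrite edge_path_cat.
have [q [k0q]] := lift (loop_path s k0ty).
rewrite map_cat catA => /map_eq_cat [q1 [q2 [eq eq1]]].
case: q2 eq => [//|y' [|//]] eq [ey']; move: k0q; rewrite eq.
rewrite edge_path_cat /= => -[k0q1 [zy' _]].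
have eqr : q1 = r by apply: lift_path_uniq k0q1 k0r _; rewrite eq1 er.
have -> : deck (pi1_class s) y = y'.
  have := @deckE s (t ++ [:: y]) (r ++ [:: y']); rewrite !last_cat /=; apply=> //.
    by rewrite edge_path_cat -eqr.
  by rewrite !map_cat er /= ey' catA.
by rewrite -eqr.
Qed.

Let deck_simplicial g : simplicial (deck g).
Proof.
move=> s sK; have /fset0Pn[x xs] := simplex_neq0 sK.
have [p_simp _ _] := p_cov.
have [|t [tK xt et]] := @lift_simplex (deck g x) _ (p_simp _ sK).
  by rewrite deck_cover; apply/imfsetP; exists x.
apply: (simplexS _ _ tK); last first.
  by apply/fset0Pn; exists (deck g x); apply/imfsetP; exists x.
apply/fsubsetP => _ /imfsetP[y /= ys ->].
have /imfsetP[z /= zt pyz] : p y \in [fset p z | z in t]%fset.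
  by rewrite et; apply/imfsetP; exists y.
suff -> : deck g y = z by [].
have sub (M : scomplex) (u : {fset M}) c d :
    simplex u -> c \in u -> d \in u -> simplex [fset c; d]%fset.
  move=> uM cu du; apply: simplexS uM; first by rewrite fsubUset !fsub1set cu.
  by apply/fset0Pn; exists c; rewrite !inE eqxx.
apply: (@lift_edge_uniq (deck g x)); last by rewrite deck_cover.
  exact/deck_edge/(sub _ s).
exact: (sub _ t).
Qed.

Let deck_lift (s : loop (p k0)) t :
  edge_path k0 t -> map p t = val s -> deck (pi1_class s) k0 = last k0 t.
Proof. by move=> k0t et; apply: (@deckE s [::]) => //; rewrite cats0. Qed.

Lemma deck_action_exists : inhabited (deck_action p k0).
Proof.
by constructor; exists deck.
Qed.

End Lifting.

(** * Right-angled Artin groups and Bestvina-Brady groups *)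

Definition raag_relators (L : scomplex) : set (word L) :=
  [set r | exists u v : L, adjacent u v /\
    r = [:: (u, true); (v, true); (u, false); (v, false)]].

Definition raag (L : scomplex) : groupType := pres (@raag_relators L).

Section Raag.
Variable L : scomplex.
Import GRing.Theory.
Local Open Scope ring_scope.

Definition raag_class (w : word L) : raag L :=
  class_of (P := pres_pregroup (@raag_relators L)) w.

Lemma raag_class_surj (x : raag L) : exists w, x = raag_class w.
Proof. exact: (@class_of_surj (pres_pregroup (@raag_relators L))). Qed.

Definition raag_gen (v : L) : raag L := raag_class [:: (v, true)].

Definition exponent_sum (w : word L) : int :=
  \sum_(a <- w) (if a.2 then 1 else -1).

Fact exponent_sum_eq w w' :
  pres_eq (@raag_relators L) w w' -> exponent_sum w = exponent_sum w'.
Proof.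
elim=> [//|//|? ? ? _ -> _ -> //|u x b v|u r v [a [c [_ ->]]]];
  rewrite /exponent_sum !big_cat !big_cons !big_nil; congr (_ + _).
- by case: b; rewrite /= ?addrA ?addr0 ?subrr ?addNr add0r.
- exact: add0r.
Qed.

(** The homomorphism [f_L]. *)
Definition height (x : raag L) : Algebra.to_multiplicative int := exponent_sum (rep x).

Lemma height_class w : height (raag_class w) = exponent_sum w.
Proof.
by apply: exponent_sum_eq; apply: (@rep_class (pres_pregroup (@raag_relators L))).
Qed.

Lemma height_gen v : height (raag_gen v) = 1.
Proof. by rewrite height_class /exponent_sum big_seq1. Qed.

Fact heightM : {morph height : x y / (x * y)%g}.
Proof.
move=> x y; rewrite -(repK x) -(repK y) -class_ofM !height_class.
exact: big_cat.
Qed.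

Fact height1 : height 1%g = 1%g.
Proof. by rewrite -class_of1 height_class /exponent_sum big_nil. Qed.

HB.instance Definition _ :=
  isMultiplicative.Build (raag L) (Algebra.to_multiplicative int) height heightM.
HB.instance Definition _ :=
  Multiplicative_isUMagmaMorphism.Build (raag L) (Algebra.to_multiplicative int)
    height height1.

Definition in_BB : {pred raag L} := [pred x | height x == 1%g].

Definition BB : Type := {x : raag L | x \in in_BB}.
HB.instance Definition _ := SubChoice.on BB.

Fact in_BB_closed : group_closed in_BB.
Proof.
split=> [|x y]; rewrite !inE ?gmulf1 // => /eqP hx /eqP hy.
by rewrite gmulfF /= hx hy divgg.
Qed.

HB.instance Definition _ :=
  SubChoice_isSubGroup.Build (raag L) in_BB BB in_BB_closed.

End Raag.

(** ** Functoriality *)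

Section RaagMap.
Variables (K L : scomplex) (f : K -> L).

Definition word_map (w : word K) : word L := [seq (f a.1, a.2) | a <- w].

(** The homomorphism induced by a simplicial map. *)
Definition raag_map (x : raag K) : raag L := raag_class (word_map (rep x)).

Hypothesis f_simp : simplicial f.

Fact word_map_eq w w' : pres_eq (@raag_relators K) w w' ->
  pres_eq (@raag_relators L) (word_map w) (word_map w').
Proof.
elim=> [v|v v' _|v v' v'' _ + _|u x b v|u r v [a [c [[ac acK] ->]]]].
- exact: pres_refl.
- exact: pres_sym.
- exact: pres_trans.
- by rewrite /word_map !map_cat; apply: pres_cancel.
- rewrite /word_map !map_cat /=; have [fac|fac] := pselect (f a = f c).
    rewrite fac.
    have h := pres_cancel (@raag_relators L)
      (word_map u ++ [:: (f c, true)]) (f c) true ((f c, false) :: word_map v).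
    rewrite -!catA in h; apply: pres_trans h _.
    exact: (pres_cancel _ _ (f c) true).
  apply: (@pres_relator _ _ _ [:: _; _; _; _]); exists (f a), (f c).
  split=> //; split=> //.
  suff <- : [fset f x | x in [fset a; c]]%fset = [fset f a; f c]%fset.
    exact: f_simp.
  by rewrite imfsetU !imfset_fset1.
Qed.

Lemma raag_map_class w : raag_map (raag_class w) = raag_class (word_map w).
Proof.
apply/class_of_eqP/word_map_eq.
exact: (@rep_class (pres_pregroup (@raag_relators K))).
Qed.

Lemma raag_map_gen v : raag_map (raag_gen v) = raag_gen (f v).
Proof. exact: raag_map_class. Qed.

Lemma raag_mapM : {morph raag_map : x y / (x * y)%g}.
Proof.
move=> x y; rewrite -(repK x) -(repK y) -class_ofM !raag_map_class -class_ofM.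
by congr class_of; apply: map_cat.
Qed.

Lemma height_raag_map x : height (raag_map x) = height x.
Proof.
rewrite -(repK x) raag_map_class !height_class /exponent_sum big_map.
exact: eq_bigr.
Qed.

End RaagMap.

Section DeckActionBB.
Variables (K L : scomplex) (p : K -> L) (k0 : K) (act : deck_action p k0).

Fact bb_act_subproof g (x : BB K) : raag_map (act g) (val x) \in @in_BB K.
Proof. by rewrite inE height_raag_map; [exact: valP x | exact: dact_simplicial]. Qed.

Definition bb_act (g : pi1 (p k0)) (x : BB K) : BB K :=
  Sub (raag_map (act g) (val x)) (bb_act_subproof g x).

Fact bb_act1 x : bb_act 1%g x = x.
Proof.
apply: val_inj => /=; have [w ->] := raag_class_surj (val x).
rewrite raag_map_class; last exact: dact_simplicial.
congr raag_class; rewrite -[RHS]map_id; apply: eq_map => -[v b] /=.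
by rewrite dact1.
Qed.

Fact bb_actM g h x : bb_act (g * h)%g x = bb_act g (bb_act h x).
Proof.
have S := dact_simplicial act.
apply: val_inj => /=; have [w ->] := raag_class_surj (val x).
rewrite !raag_map_class //; congr raag_class; rewrite /word_map -map_comp; apply: eq_map => -[v b] /=.
by rewrite dactM.
Qed.

Fact bb_act_morph g : {morph bb_act g : x y / (x * y)%g}.
Proof.
move=> x y; apply: val_inj.
rewrite [RHS]valM [LHS]/(raag_map _ (val (x * y)%g)) valM.
exact/raag_mapM/dact_simplicial.
Qed.

(** The action of the fundamental group of [L] on [BB K] obtained by permuting
    the vertices of [K]. *)
Definition bb_action : gaction (pi1 (p k0)) (BB K) :=
  GAction bb_act1 bb_actM bb_act_morph.

End DeckActionBB.

(* Main.v *)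
Require Import Defs.
From HB Require Import structures.
From mathcomp Require Import all_boot all_order all_algebra finmap zify.
From mathcomp Require Import boolp classical_sets functions cardinality.

Set Implicit Arguments.
Unset Strict Implicit.
Unset Printing Implicit Defensive.

Local Open Scope classical_set_scope.
Local Open Scope group_scope.

(** Write [A_L] for [raag L]; the vertices of [L] are its generators. Fix a base
    vertex [k0] and, for each vertex [u], an edge path from [k0] to [u].

    Presentations. [BB L] is generated by the elements [y_u = k0 u^-1]. For an
    edge from [u] to [v] the element [e = y_u^-1 y_v = u v^-1] satisfies
    [e^h = u^h v^-h], because [u] and [v] commute; so the product [gamma u h] of
    the [h]-th powers of the edges of the path to [u] is [k0^h u^-h]. A letter
    [u] or [u^-1] read at height [h] and leading to height [h'] is, after
    multiplication by powers of [k0] on both sides,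
    [k0^h u^(h'-h) k0^-h' = gamma u h (gamma u h')^-1]; this expresses any word
    of exponent sum 0 through the [y_u] ([bb_rewrite]). The rewriting respects the
    commutation relators of [A_L] as soon as
    [gamma v h = gamma u h (y_u^-1 y_v)^h] for all edges, so any set of
    true relators implying these equations and [y_k0 = 1] presents [BB L]
    ([bb_gen_faithful], [bb_gen_surj]). When the complex is simply connected,
    paths with the same ends are homotopic and it is enough that the edges of each
    triangle commute: finitely many relators ([bb_finitely_presented]). In general
    one takes the [h]-th powers of the loops made of the path to [u], the edge and
    the path back from [v]: finitely many families indexed by [h], which form a
    recursively enumerable set ([bb_recursively_presented]). An extension of a
    finitely presented group by a finite group is finitely presented
    ([sdprod_finitely_presented]); this settles [BB K] and the semidirect product
    [G].

    Torsion. Right-angled Artin groups have unique reduced words up to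
    commutations ([reduced_uniq]); conjugating an element so that its reduced word
    is cyclically reduced makes all its powers reduced, hence there is no torsion
    ([raag_torsion_free]). So [BB K] is a torsion-free subgroup of finite index of
    [G], and the map from [G] to [BB L] kills the torsion. Conversely the conjugate
    [b (g b)^-1 g] of [g] by an element [b] of [A_K] has finite order and lies in
    [G]. Comparing those of [b] and [b v] shows that modulo torsion a vertex [v] of
    [K] is identified with [g v]; as deck transformations are transitive on the
    fibres, what remains is the group of [L] ([cover_bb_kernel]).

    Infinite presentability. Let [g] in [A_L] stand for the vertex [g^-1] of the
    CAT(0) cube complex on which [A_L] acts, so that multiplying [g] on the left by
    letters follows edges. The last letters of the reduced word of [g <> 1] form a
    simplex of [L]: inverted, they are the first letters of [g^-1], the direction
    at the vertex 1 of the geodesics to [g^-1]. This direction varies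
    continuously along edges and squares that avoid the vertex 1, so each path
    avoiding 1 has a holonomy in the fundamental group of [L], invariant under the
    commutation of squares that avoid 1. If [BB L] had a finite presentation, its
    finitely many relators would have null-homotopies of bounded height; started
    high enough they avoid 1, so that all relations of [BB L] would have trivial
    holonomy when started at one and the same height ([sub_bound]). But for an edge
    loop [u_0, u_1, ..., u_m = u_0] the word
    [(u_0 u_1^-1)^n (u_1 u_2^-1)^n ... (u_(m-1) u_m^-1)^n] is trivial in [A_L], and
    its path started at [u_0^n] runs around the vertex 1, at distance [n] or
    [n-1], with the class of the loop as holonomy ([holonomy_power_word]). So the
    fundamental group would be trivial ([bb_not_finitely_presented]). *)

(** * Words and presentations *)

Lemma isomorphic_morph (G H : groupType) (f : G -> H) :
  {morph f : x y / x * y} -> bijective f -> isomorphic G H.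
Proof.
move=> fM fB; pose m := isMultiplicative.Build G H f fM.
by exists (HB.pack_for {multiplicative G -> H} f m).
Qed.

Section GroupMorphisms.
Variables (G H : groupType) (f : G -> H) (fM : {morph f : x y / x * y}).

Lemma morph_one : f 1 = 1.
Proof. by apply: (mulgI (f 1)); rewrite -fM !mulg1. Qed.

Lemma morph_inv x : f x^-1 = (f x)^-1.
Proof. by apply: (mulIg (f x)); rewrite -fM !mulVg morph_one. Qed.

Lemma morph_exp x n : f (x ^+ n) = f x ^+ n.
Proof. by elim: n => [|n IHn]; rewrite ?morph_one // !expgS fM IHn. Qed.

End GroupMorphisms.

Lemma first_isomorphism (G H : groupType) (N : nsubgroup G) (f : G -> H) :
  {morph f : x y / x * y} -> (forall h, exists g, f g = h) ->
  (forall g, f g = 1 <-> nset N g) -> isomorphic (quotient N) H.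
Proof.
move=> fM f_surj f_ker; pose c := class_of (P := quotient_pregroup N).
have cP x y : c x = c y <-> f x = f y.
  have eqP : f x = f y <-> f (x^-1 * y) = 1.
    rewrite fM (morph_inv fM); split=> [->|]; first by rewrite mulVg.
    by move=> /(canRL (mulKg _)); rewrite invgK mulg1.
  by rewrite eqP f_ker; apply: class_of_eqP.
pose h (x : quotient N) := f (rep x).
have hE x : h (c x) = f x by apply/cP/repK.
have [g fg] := choice f_surj.
apply: (@isomorphic_morph _ _ h) => [x y|].
  have [[x' ->] [y' ->]] := (class_of_surj x, class_of_surj y).
  by rewrite -class_ofM -![class_of _]/(c _) !hE fM.
exists (c \o g) => [x|y] /=; last by rewrite hE.
by have [x' ->] := class_of_surj x; apply/cP; rewrite fg hE.
Qed.

Section Evaluation.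
Variable X : Type.
Implicit Types (w v : word X).

Definition letter_val (G : groupType) (x : X -> G) (a : X * bool) : G :=
  if a.2 then x a.1 else (x a.1)^-1.

Fixpoint weval (G : groupType) (x : X -> G) w : G :=
  if w is a :: w' then letter_val x a * weval x w' else 1.

Lemma weval_cat (G : groupType) (x : X -> G) w v :
  weval x (w ++ v) = weval x w * weval x v.
Proof. by elim: w => [|a w IHw] /=; rewrite ?mul1g // IHw mulgA. Qed.

Lemma letter_valN (G : groupType) (x : X -> G) a b :
  letter_val x (a, ~~ b) = (letter_val x (a, b))^-1.
Proof. by case: b; rewrite /letter_val //= invgK. Qed.

Lemma weval_winv (G : groupType) (x : X -> G) w :
  weval x (winv w) = (weval x w)^-1.
Proof.
elim: w => [|[a b] w IHw] /=; first by rewrite invg1.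
rewrite /winv /= rev_cons -cats1 weval_cat [weval x (rev _)]IHw /=.
by rewrite letter_valN mulg1 invgM.
Qed.

Lemma eq_weval (G : groupType) (x y : X -> G) : x =1 y -> weval x =1 weval y.
Proof. by move=> xy; elim=> //= a w ->; rewrite /letter_val xy. Qed.

Lemma weval_morph (G H : groupType) (f : G -> H) (x : X -> G) w :
  {morph f : a b / a * b} -> f (weval x w) = weval (f \o x) w.
Proof.
move=> fM; elim: w => [|[a b] w IHw] /=; first exact: morph_one.
by rewrite fM IHw; case: b; rewrite /letter_val //= morph_inv.
Qed.

Lemma weval_nseq (G : groupType) (x : X -> G) w n :
  weval x (flatten (nseq n w)) = weval x w ^+ n.
Proof. by elim: n => //= n IHn; rewrite weval_cat IHn expgS. Qed.

End Evaluation.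

Lemma weval_map (X Y : Type) (G : groupType) (f : X -> Y) (y : Y -> G) w :
  weval y [seq (f a.1, a.2) | a <- w] = weval (y \o f) w.
Proof. by elim: w => //= a w ->. Qed.

Section Presentations.
Variables (X : choiceType) (R : set (word X)).

Definition pres_class (w : word X) : pres R :=
  class_of (P := pres_pregroup R) w.

Definition pres_gen (x : X) : pres R := pres_class [:: (x, true)].

Lemma pres_class_surj (g : pres R) : exists w, g = pres_class w.
Proof. exact: (@class_of_surj (pres_pregroup R)). Qed.

Lemma pres_class_eqP w v : pres_class w = pres_class v <-> pres_eq R w v.
Proof. exact: class_of_eqP. Qed.

Lemma pres_class_cat w v : pres_class (w ++ v) = pres_class w * pres_class v.
Proof. exact: (@class_ofM (pres_pregroup R)). Qed.

Lemma pres_classE w : pres_class w = weval pres_gen w.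
Proof.
elim: w => [|[x b] w IHw] //=; rewrite -IHw -cat1s pres_class_cat.
congr (_ * _); case: b; rewrite /letter_val //=.
apply: (mulIg (pres_gen x)); rewrite mulVg -pres_class_cat.
exact/pres_class_eqP/(pres_cancel R [::] x false [::]).
Qed.

Lemma pres_class_rel r : R r -> pres_class r = 1.
Proof.
move=> Rr; apply/pres_class_eqP.
by have := pres_relator [::] [::] Rr; rewrite /= cats0.
Qed.

Variables (G : groupType) (x : X -> G).

Lemma weval_pres_eq : (forall r, R r -> weval x r = 1) ->
  forall w v, pres_eq R w v -> weval x w = weval x v.
Proof.
move=> x_rel w v; elim=> [//|//|? ? ? _ -> _ -> //|u a b t|u r t Rr];
  rewrite !weval_cat.
- by rewrite /= letter_valN mulg1 mulgV mul1g.
- by rewrite (x_rel _ Rr) mul1g.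
Qed.

(** The homomorphism given by the universal property of a presentation. *)
Lemma pres_lift : (forall r, R r -> weval x r = 1) ->
  exists2 f : pres R -> G, {morph f : a b / a * b} &
    forall w, f (pres_class w) = weval x w.
Proof.
move=> x_rel; pose f (g : pres R) := weval x (rep g).
have fE w : f (pres_class w) = weval x w.
  by apply: weval_pres_eq => //; apply/pres_class_eqP/repK.
exists f => // a b.
have [[w ->] [v ->]] := (pres_class_surj a, pres_class_surj b).
by rewrite -pres_class_cat !fE weval_cat.
Qed.

(** A group is presented by [R] on generators [x] once the relators hold, the
    [x] generate, and every word vanishing in the group is a consequence of the
    relators. *)
Lemma pres_isomorphic :
  (forall r, R r -> weval x r = 1) ->
  (forall g, exists w, weval x w = g) ->
  (forall w, weval x w = 1 -> pres_class w = 1) ->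
  isomorphic (pres R) G.
Proof.
move=> x_rel x_gen x_faithful; have [f fM fE] := pres_lift x_rel.
apply: (isomorphic_morph fM).
have [h fh] : exists h, forall g, f (h g) = g.
  by have /choice[h wh] := x_gen; exists (pres_class \o h) => g /=; rewrite fE.
exists h => // a; apply: divg1_eq; have [w ew] := pres_class_surj (h (f a) / a).
rewrite ew; apply: x_faithful.
by rewrite -fE -ew fM (morph_inv fM) fh mulgV.
Qed.

End Presentations.

Lemma pres_eq_map (X Y : choiceType) (f : X -> Y) (R : set (word X))
    (S : set (word Y)) w v :
  (forall r, R r -> S [seq (f a.1, a.2) | a <- r]) -> pres_eq R w v ->
  pres_eq S [seq (f a.1, a.2) | a <- w] [seq (f a.1, a.2) | a <- v].
Proof.
move=> RS; elim=> [t|t t' _|t t' t'' _ + _|u x b t|u r t Rr].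
- exact: pres_refl.
- exact: pres_sym.
- exact: pres_trans.
- by rewrite !map_cat; apply: pres_cancel.
- by rewrite !map_cat; apply/pres_relator/RS.
Qed.

(** Presentations on a finite set of generators are transported to an alphabet
    ['I_n]. *)
Section Relabelling.
Variables (X : choiceType).
Hypothesis X_fin : finite_set [set: X].

Lemma finite_enum :
  exists n (e : 'I_n -> X) (c : X -> 'I_n), cancel e c /\ cancel c e.
Proof.
have /finite_seqP[s es] := X_fin.
have sP x : x \in undup s by rewrite mem_undup; have : [set: X] x by []; rewrite es.
have ltI x : (index x (undup s) < size (undup s))%N by rewrite index_mem.
case: (posnP (size (undup s))) => [s0|s_gt0].
  have noX (x : X) : False by have := ltI x; rewrite s0.
  have noI (i : 'I_0) : False by case: i.
  exists 0%N, (fun i => False_rect X (noI i)), (fun x => False_rect 'I_0 (noX x)).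
  by split=> [i|x]; [case: (noI i)|case: (noX x)].
have x0 : X by case: (undup s) s_gt0.
exists (size (undup s)), (fun i => nth x0 (undup s) i), (fun x => Ordinal (ltI x)).
split=> [i|x]; last exact: nth_index.
by apply: val_inj; rewrite /= index_uniq ?undup_uniq.
Qed.

Variables (n : nat) (e : 'I_n -> X) (c : X -> 'I_n).
Hypotheses (eK : cancel e c) (cK : cancel c e).

Definition relabel (w : word X) : word 'I_n := [seq (c a.1, a.2) | a <- w].

Lemma relabelK w : [seq (e a.1, a.2) | a <- relabel w] = w.
Proof. by rewrite -map_comp map_id_in // => -[x b] _ /=; rewrite cK. Qed.

Lemma relabel_isomorphic (R : set (word X)) (G : groupType) (x : X -> G) :
  (forall r, R r -> weval x r = 1) ->
  (forall g, exists w, weval x w = g) ->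
  (forall w, weval x w = 1 -> pres_class R w = 1) ->
  isomorphic (pres (relabel @` R)) G.
Proof.
move=> x_rel x_gen x_faithful.
have x_relabel w : weval (x \o e) (relabel w) = weval x w.
  by rewrite -weval_map relabelK.
apply: (@pres_isomorphic _ _ _ (x \o e)) => [_ [r Rr <-]|g|w].
- by rewrite x_relabel x_rel.
- by have [w <-] := x_gen g; exists (relabel w).
rewrite -weval_map => /x_faithful /pres_class_eqP ew.
have /(@pres_eq_map _ _ c _ (relabel @` R)) := ew => /(_ _) /pres_class_eqP.
rewrite -map_comp map_id_in; last by move=> [i b] _ /=; rewrite eK.
by apply=> r Rr; exists r.
Qed.

End Relabelling.

Lemma finitely_presentedI (X : choiceType) (R : set (word X)) (G : groupType)
    (x : X -> G) : finite_set [set: X] -> finite_set R ->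
  (forall r, R r -> weval x r = 1) ->
  (forall g, exists w, weval x w = g) ->
  (forall w, weval x w = 1 -> pres_class R w = 1) ->
  finitely_presented G.
Proof.
move=> X_fin R_fin x_rel x_gen x_faithful.
have [n [e [c [eK cK]]]] := finite_enum X_fin.
exists n, (relabel c @` R); split; first exact: finite_image.
exact: relabel_isomorphic x_rel x_gen x_faithful.
Qed.

(** * Integral powers and powers of edge paths *)

Section IntegralPower.
Variable G : groupType.
Implicit Types (x y : G) (h : int).

Definition zexp x h : G :=
  match h with Posz n => x ^+ n | Negz n => x ^- n.+1 end.

Lemma zexpS x h : zexp x (h + 1)%R = zexp x h * x.
Proof.
case: h => [n|[|n]].
- have -> : (Posz n + 1 = Posz n.+1)%R by lia.
  by rewrite /= expgSr.
- by rewrite /= mulVg.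
- have -> : (Negz n.+1 + 1 = Negz n)%R by lia.
  by rewrite /= [in RHS]expgS invgM mulgVK.
Qed.

Lemma zexp_step x h (b : bool) :
  (zexp x h)^-1 * zexp x (h + (if b then 1 else -1))%R = if b then x else x^-1.
Proof.
case: b; first by rewrite zexpS mulKg.
by rewrite -{1}(GRing.subrK 1%R h) zexpS invgM mulgVK.
Qed.

Lemma zexpM x y h : commute x y -> zexp (x * y) h = zexp x h * zexp y h.
Proof.
move=> xy; case: h => n /=; rewrite expgMn // invgM.
by rewrite -!expVgn; apply/commuteX2/commute_sym/commuteV/commute_sym/commuteV.
Qed.

Lemma zexpV x h : zexp x^-1 h = (zexp x h)^-1.
Proof. by case: h => n /=; rewrite expVgn. Qed.

Lemma one_zexp h : zexp 1 h = 1.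
Proof. by case: h => n /=; rewrite expg1n ?invg1. Qed.

End IntegralPower.

Lemma zexp_morph (G H : groupType) (f : G -> H) x h :
  {morph f : a b / a * b} -> f (zexp x h) = zexp (f x) h.
Proof.
by move=> fM; case: h => n; rewrite /zexp ?morph_inv ?(morph_exp fM).
Qed.

(** For a family [y] of group elements indexed by vertices, an edge from [x] to
    [z] stands for [(y x)^-1 * y z], and an edge path for the product of the
    [h]-th powers of its edges. *)
Section PathPower.
Variables (L : scomplex) (G : groupType) (y : L -> G) (h : int).

Fixpoint path_power (x : L) (s : seq L) : G :=
  if s is z :: s' then zexp ((y x)^-1 * y z) h * path_power z s' else 1.

Lemma path_power_cat x s t :
  path_power x (s ++ t) = path_power x s * path_power (last x s) t.
Proof. by elim: s x => [|z s IHs] x /=; rewrite ?mul1g // IHs mulgA. Qed.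

Lemma path_power_rev x s :
  path_power (last x s) (rev (belast x s)) = (path_power x s)^-1.
Proof.
elim: s x => [|z s IHs] x /=; first by rewrite invg1.
rewrite rev_cons -cats1 path_power_cat IHs last_rev_belast /= mulg1.
by rewrite invgM -zexpV invgM invgK.
Qed.

End PathPower.

Lemma path_power0 (L : scomplex) (G : groupType) (y : L -> G) x s :
  path_power y 0 x s = 1.
Proof. by elim: s x => //= z s IHs x; rewrite IHs mulg1. Qed.

Lemma path_power1 (L : scomplex) (G : groupType) (y : L -> G) x s :
  path_power y 1 x s = (y x)^-1 * y (last x s).
Proof.
elim: s x => [|z s IHs] x /=; first by rewrite mulVg.
by rewrite IHs expg1 mulgA mulgK.
Qed.

Lemma path_power_morph (L : scomplex) (G H : groupType) (f : G -> H)
    (y : L -> G) h x s : {morph f : a b / a * b} ->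
  f (path_power y h x s) = path_power (f \o y) h x s.
Proof.
move=> fM; elim: s x => [|z s IHs] x /=; first exact: morph_one.
by rewrite fM IHs zexp_morph // fM morph_inv.
Qed.

(** * Presentations of Bestvina-Brady groups *)

Section RaagBasics.
Variable L : scomplex.

Definition letter_sign (a : L * bool) : int := (if a.2 then 1 else -1)%R.

Lemma exponent_sum_cons a (w : word L) :
  exponent_sum (a :: w) = (letter_sign a + exponent_sum w)%R.
Proof. exact: big_cons. Qed.

Lemma exponent_sum_nil : exponent_sum ([::] : word L) = 0%R.
Proof. exact: big_nil. Qed.

Lemma raag_classE (w : word L) : raag_class w = weval (@raag_gen L) w.
Proof. exact: pres_classE. Qed.

Lemma raag_class_cat (w v : word L) :
  raag_class (w ++ v) = raag_class w * raag_class v.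
Proof. exact: pres_class_cat. Qed.

Lemma raag_class_eqP (w v : word L) :
  raag_class w = raag_class v <-> pres_eq (@raag_relators L) w v.
Proof. exact: pres_class_eqP. Qed.

Lemma raag_gen_commute (u v : L) : simplex [fset u; v]%fset ->
  commute (raag_gen u) (raag_gen v).
Proof.
move=> uv; have [->//|/eqP nuv] := eqVneq u v.
have : weval (@raag_gen L) [:: (u, true); (v, true); (u, false); (v, false)] = 1.
  rewrite -raag_classE; apply: pres_class_rel; exists u, v.
  by split.
rewrite /= /letter_val /= !mulgA mulg1 -mulgA -invgM => /divg1_eq.
by [].
Qed.

End RaagBasics.

Section DicksLeary.
Variables (L : scomplex) (k0 : L) (path_to : L -> seq L).
Hypothesis path_toP : forall u, edge_path k0 (path_to u) /\ last k0 (path_to u) = u.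

Definition bb_gen_val (u : L) : raag L := raag_gen k0 * (raag_gen u)^-1.

Fact bb_gen_subproof u : bb_gen_val u \in @in_BB L.
Proof.
by rewrite inE /bb_gen_val gmulfF /= !height_gen divgg.
Qed.

Definition bb_gen (u : L) : BB L := Sub (bb_gen_val u) (bb_gen_subproof u).

Lemma bb_gen_edge (u v : L) :
  (bb_gen_val u)^-1 * bb_gen_val v = raag_gen u * (raag_gen v)^-1.
Proof. by rewrite /bb_gen_val invgM invgK mulgA mulgVK. Qed.

(** In the right-angled Artin group the powers of edges telescope, since the ends
    of an edge commute. *)
Lemma path_power_raag h x s : edge_path x s ->
  path_power bb_gen_val h x s =
  zexp (raag_gen x) h * (zexp (raag_gen (last x s)) h)^-1.
Proof.
elim: s x => [|z s IHs] x /=; first by rewrite mulgV.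
move=> [xz /IHs ->]; rewrite bb_gen_edge zexpM; last first.
  exact/commuteV/raag_gen_commute.
by rewrite zexpV mulgA mulgVK.
Qed.

Variable R : set (word L).
Let y : L -> pres R := pres_gen R.
Let gamma (u : L) (h : int) := path_power y h k0 (path_to u).

Hypothesis R_rel : forall r, R r -> weval bb_gen_val r = 1.
Hypothesis R_base : y k0 = 1.
Hypothesis R_edge : forall u v h, adjacent u v ->
  gamma v h = gamma u h * zexp ((y u)^-1 * y v) h.

(** In [BB L] this is [k0 ^ h * w * k0 ^ - h'], where [h'] is [h] plus the exponent
    sum of [w]. *)
Fixpoint bb_rewrite (h : int) (w : word L) : pres R :=
  if w is a :: w' then
    let h' := (h + letter_sign a)%R in
    gamma a.1 h * (gamma a.1 h')^-1 * bb_rewrite h' w'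
  else 1.

Lemma bb_rewrite_cat h w v : bb_rewrite h (w ++ v) =
  bb_rewrite h w * bb_rewrite (h + exponent_sum w)%R v.
Proof.
elim: w h => [|a w IHw] h /=; first by rewrite exponent_sum_nil GRing.addr0 mul1g.
by rewrite IHw exponent_sum_cons GRing.addrA mulgA.
Qed.

(** With [e] the edge from [u] to [v], both orders of reading [u] and [v] give
    [gamma u h * e^-1 * (gamma u (h + 2))^-1]. *)
Lemma bb_rewrite_relator h u v : adjacent u v ->
  bb_rewrite h [:: (u, true); (v, true); (u, false); (v, false)] = 1.
Proof.
move=> uv; rewrite /= /letter_sign /= !(R_edge _ uv).
set e := _^-1 * y v; set a := (h + 1)%R.
have -> : (a + 1 + -1 = a)%R by rewrite GRing.addrK.
have -> : (a + -1 = h)%R by rewrite /a GRing.addrK.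
rewrite (zexpS e a) !invgM !mulg1 !mulgA !mulgVK (zexpS e h).
by rewrite !mulgA !mulgK mulgV.
Qed.

Lemma bb_rewrite_eq w w' : pres_eq (@raag_relators L) w w' ->
  forall h, bb_rewrite h w = bb_rewrite h w'.
Proof.
elim=> [//|? ? _ IH h|? ? ? _ IH1 _ IH2 h|u x b v h|u r v [s [t [st ->]]] h].
- by rewrite IH.
- by rewrite IH1 IH2.
- rewrite !bb_rewrite_cat; set k := (h + _)%R.
  have e : (letter_sign (x, b) + letter_sign (x, ~~ b) = 0)%R by case: b.
  have -> : exponent_sum [:: (x, b); (x, ~~ b)] = 0%R.
    by rewrite !exponent_sum_cons exponent_sum_nil GRing.addr0 e.
  rewrite GRing.addr0 /= -[(k + _ + _)%R]GRing.addrA e GRing.addr0.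
  by rewrite mulg1 !mulgA !mulgVK mulgK.
- rewrite !bb_rewrite_cat bb_rewrite_relator // mul1g.
  have -> : exponent_sum [:: (s, true); (t, true); (s, false); (t, false)] = 0%R.
    by rewrite !exponent_sum_cons exponent_sum_nil.
  by rewrite GRing.addr0.
Qed.

Let gamma0 u : gamma u 0 = 1. Proof. exact: path_power0. Qed.

Let gamma1 u : gamma u 1 = y u.
Proof. by rewrite /gamma path_power1 (path_toP u).2 R_base invg1 mul1g. Qed.

(** The word in the vertices obtained by replacing each generator [y_u] of [BB L]
    by [k0 u^-1]. *)
Definition bb_subst (w : word L) : word L :=
  flatten [seq if a.2 then [:: (k0, true); (a.1, false)]
               else [:: (a.1, true); (k0, false)] | a <- w].

Lemma bb_substE w : raag_class (bb_subst w) = weval bb_gen_val w.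
Proof.
rewrite raag_classE; elim: w => //= -[u b] w <-.
rewrite /bb_subst /= weval_cat; congr (_ * _); rewrite /letter_val.
by case: b; rewrite /= /letter_val /= mulg1 // /bb_gen_val invgM invgK.
Qed.

Lemma bb_rewrite_subst w : bb_rewrite 0 (bb_subst w) = pres_class R w.
Proof.
rewrite pres_classE; elim: w => //= -[u b] w <-.
rewrite /bb_subst /= bb_rewrite_cat; congr (_ * _); last first.
  congr (bb_rewrite _ _).
  by case: b; rewrite !exponent_sum_cons exponent_sum_nil.
by case: b; rewrite /= /letter_sign /= !gamma0 !gamma1 R_base /letter_val /=
  !(mul1g, mulg1, invg1).
Qed.

Lemma val_weval_bb w : val (weval bb_gen w) = weval bb_gen_val w.
Proof. by rewrite (weval_morph _ _ (@valM _ _ (BB L))). Qed.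

Lemma bb_gen_relators r : R r -> weval bb_gen r = 1.
Proof. by move=> Rr; apply: val_inj; rewrite val_weval_bb R_rel. Qed.

(** Rewriting is a left inverse of substitution, and it only depends on the element
    of the right-angled Artin group. *)
Lemma bb_gen_faithful w : weval bb_gen w = 1 -> pres_class R w = 1.
Proof.
move=> /(congr1 val); rewrite val_weval_bb -bb_substE => w1.
by rewrite -bb_rewrite_subst (@bb_rewrite_eq _ [::]) //; apply/raag_class_eqP.
Qed.

(** Evaluating the rewriting of a word of exponent sum 0 gives the word back. *)
Lemma bb_gen_surj g : exists w, weval bb_gen w = g.
Proof.
have [f fM fE] := pres_lift R_rel.
have fy u : f (y u) = bb_gen_val u by rewrite fE /= mulg1.
have fgamma u k : f (gamma u k) =
    zexp (raag_gen k0) k * (zexp (raag_gen u) k)^-1.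
  have [ku lu] := path_toP u; rewrite /gamma path_power_morph //.
  by rewrite -[in RHS]lu -path_power_raag //; congr path_power; apply/funext.
have f_rewrite h w : f (bb_rewrite h w) = zexp (raag_gen k0) h * raag_class w *
    (zexp (raag_gen k0) (h + exponent_sum w)%R)^-1.
  elim: w h => [|[u b] w IHw] h /=.
    rewrite exponent_sum_nil GRing.addr0 (morph_one fM) raag_classE /= mulg1.
    by rewrite mulgV.
  rewrite !fM (morph_inv fM) !fgamma IHw exponent_sum_cons GRing.addrA.
  rewrite -cat1s raag_class_cat invgM invgK !mulgA mulgVK.
  rewrite -[_ * (zexp (raag_gen u) h)^-1 * _]mulgA zexp_step.
  by rewrite [raag_class [:: _]]raag_classE /= mulg1.
have [w ew] := raag_class_surj (val g).
have hw : exponent_sum w = 0%R.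
  by have /eqP := valP g; rewrite ew height_class.
have [v ev] := pres_class_surj (bb_rewrite 0 w); exists v.
apply: val_inj; rewrite val_weval_bb -fE -ev f_rewrite hw /= ew.
by rewrite mul1g invg1 mulg1.
Qed.

End DicksLeary.
(** * Recursive enumerability of families of powers *)

Section BlockPower.
Variable X : Type.

(** [block_power m [:: B1; ...; Bk]] is the word [B1 ^ m ... Bk ^ m]. *)
Definition block_power m (Bs : seq (word X)) : word X :=
  flatten [seq flatten (nseq m B) | B <- Bs].

Definition block_powers (S : set (seq (word X))) : set (word X) :=
  [set w | exists Bs m, S Bs /\ w = block_power m Bs].

End BlockPower.

Lemma block_power_map (X Y : Type) (f : X -> Y) m (Bs : seq (word X)) :
  [seq (f a.1, a.2) | a <- block_power m Bs] =
  block_power m [seq [seq (f a.1, a.2) | a <- B] | B <- Bs].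
Proof.
rewrite /block_power map_flatten -!map_comp; congr flatten.
by apply: eq_map => B /=; rewrite map_flatten map_nseq.
Qed.

Section PrimitiveRecursion.
Implicit Types (f g h : recfun) (F G H : seq nat -> nat).

(** The recursive function [f] is total on lists of length [k], with values given
    by [F]. *)
Definition computes k f F :=
  forall xs, size xs = k -> forall y, rec_eval f xs y <-> y = F xs.

Lemma computes_proj k i : computes k (RProj i) (fun xs => nth 0%N xs i).
Proof. by []. Qed.

Lemma computes_zero k : computes k RZero (fun=> 0%N).
Proof. by []. Qed.

Arguments computes_proj k i : clear implicits.
Arguments computes_zero k : clear implicits.

Lemma computes_comp1 k g h G H : computes 1 g G -> computes k h H ->
  computes k (RComp g [:: h]) (fun xs => G [:: H xs]).
Proof.
move=> gG hH xs kxs y; split=> /= [[[//|z [|z' zs]] gz [//hz ?]]|->].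
  by move: gz; have /(hH _ kxs) -> := hz; rewrite gG.
by exists [:: H xs]; [apply/gG | split=> //; apply/hH].
Qed.

Lemma computes_comp2 k g h1 h2 G H1 H2 :
  computes 2 g G -> computes k h1 H1 -> computes k h2 H2 ->
  computes k (RComp g [:: h1; h2]) (fun xs => G [:: H1 xs; H2 xs]).
Proof.
move=> gG h1H h2H xs kxs y; split=> /= [[[|z [|t [|z' zs]]] gz // hs]|->].
- by case: hs.
- case: hs gz => hz [ht _] gz; apply/(gG [:: _; _] erefl).
  by rewrite -(proj1 (h1H _ kxs _) hz) -(proj1 (h2H _ kxs _) ht).
- by case: hs => ? [].
- by exists [:: H1 xs; H2 xs]; [apply/gG | do !split=> //; [apply/h1H|apply/h2H]].
Qed.

(** The equations defining [F] by primitive recursion on the head of the list. *)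
Lemma computes_prim k g h G H F : computes k g G -> computes k.+2 h H ->
  (forall xs, size xs = k -> F (0%N :: xs) = G xs) ->
  (forall xs n, size xs = k -> F (n.+1 :: xs) = H [:: n, F (n :: xs) & xs]) ->
  computes k.+1 (RPrim g h) F.
Proof.
move=> gG hH F0 FS [//|n xs] [kxs] /=; elim: n => [|n IHn] y.
  by rewrite F0 // gG.
rewrite FS //; split=> [[z /IHn ->]|->]; first by rewrite hH //= kxs.
by exists (F (n :: xs)); [apply/IHn | apply/hH; rewrite //= kxs].
Qed.

Lemma computes_ext k f F G : (forall xs, size xs = k -> F xs = G xs) ->
  computes k f F -> computes k f G.
Proof. by move=> FG fF xs kxs y; rewrite fF // FG. Qed.

Definition rsucc f := RComp RSucc [:: f].

Lemma computes_succ k f F : computes k f F -> computes k (rsucc f) (fun xs => (F xs).+1).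
Proof.
by move=> fF; apply: (@computes_comp1 _ _ _ (fun xs => (head 0%N xs).+1)).
Qed.

Definition raddc c f := iter c rsucc f.

Lemma computes_addc k c f F :
  computes k f F -> computes k (raddc c f) (fun xs => (c + F xs)%N).
Proof. by move=> fF; elim: c => //= c IHc; apply: computes_succ. Qed.

Definition rmulc c f := RComp (RPrim RZero (raddc c (RProj 1))) [:: f].

Lemma computes_mulc k c f F :
  computes k f F -> computes k (rmulc c f) (fun xs => (c * F xs)%N).
Proof.
apply: (@computes_comp1 _ _ _ (fun xs => (c * head 0 xs)%N)).
apply: computes_prim (computes_zero _) (computes_addc c (computes_proj _ 1)) _ _.
  by move=> xs _ /=; rewrite muln0.
by move=> xs n _ /=; rewrite mulnS.
Qed.

Definition rpred f := RComp (RPrim RZero (RProj 0)) [:: f].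

Lemma computes_pred k f F : computes k f F -> computes k (rpred f) (fun xs => (F xs).-1).
Proof.
apply: (@computes_comp1 _ _ _ (fun xs => (head 0%N xs).-1)).
exact: computes_prim (computes_zero _) (computes_proj _ 0) _ _.
Qed.

Definition rsub f g := RComp (RPrim (RProj 0) (rpred (RProj 1))) [:: g; f].

Lemma computes_sub k f g F G : computes k f F -> computes k g G ->
  computes k (rsub f g) (fun xs => (F xs - G xs)%N).
Proof.
move=> fF gG; apply: (@computes_comp2 _ _ _ _
  (fun xs => (nth 0 xs 1 - nth 0 xs 0)%N)) gG fF.
apply: computes_prim (computes_proj _ 0) (computes_pred (computes_proj _ 1)) _ _.
  by move=> xs _ /=; rewrite subn0.
by move=> xs n _ /=; rewrite subnS.
Qed.

Definition radd f g := RComp (RPrim (RProj 0) (rsucc (RProj 1))) [:: f; g].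

Lemma computes_add k f g F G : computes k f F -> computes k g G ->
  computes k (radd f g) (fun xs => (F xs + G xs)%N).
Proof.
move=> fF gG; apply: (@computes_comp2 _ _ _ _
  (fun xs => (nth 0 xs 0 + nth 0 xs 1)%N)) fF gG.
exact: computes_prim (computes_proj _ 0) (computes_succ (computes_proj _ 1)) _ _.
Qed.

Definition rmul f g :=
  RComp (RPrim RZero (radd (RProj 1) (RProj 2))) [:: f; g].

Lemma computes_mul k f g F G : computes k f F -> computes k g G ->
  computes k (rmul f g) (fun xs => (F xs * G xs)%N).
Proof.
move=> fF gG; apply: (@computes_comp2 _ _ _ _
  (fun xs => (nth 0 xs 0 * nth 0 xs 1)%N)) fF gG.
apply: computes_prim (computes_zero _)
  (computes_add (computes_proj _ 1) (computes_proj _ 2)) _ _ => //.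
by move=> xs n _ /=; rewrite mulSn addnC.
Qed.

End PrimitiveRecursion.
Arguments computes_proj k i : clear implicits.
Arguments computes_zero k : clear implicits.

Section PowersEnumerable.
Variable n : nat.
Implicit Types (B : word 'I_n) (Bs : seq (word 'I_n)).

Definition rprefix B f :=
  foldr (fun (a : 'I_n * bool) g => raddc (2 * a.1 + a.2).+1 (rmulc (2 * n) g)) f B.

Fixpoint rpowers Bs :=
  if Bs is B :: Bs' then
    RComp (RPrim (rpowers Bs') (rprefix B (RProj 1))) [:: RProj 0; RProj 0]
  else RZero.

Lemma computes_powers Bs :
  computes 1 (rpowers Bs) (fun xs => word_code (block_power (head 0%N xs) Bs)).
Proof.
elim: Bs => [|B Bs IHBs] //=.
pose F (xs : seq nat) := word_code
  (flatten (nseq (nth 0%N xs 0) B) ++ block_power (nth 0%N xs 1) Bs).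
have FP : computes 2 (RPrim (rpowers Bs) (rprefix B (RProj 1))) F.
  pose pre m := foldr (fun (a : 'I_n * bool) c => (2 * a.1 + a.2).+1 + 2 * n * c)%N m B.
  have preE w : pre (word_code w) = word_code (B ++ w).
    by rewrite /pre /word_code foldr_cat.
  have hP : computes 3 (rprefix B (RProj 1)) (fun xs => pre (nth 0%N xs 1)).
    rewrite /pre /rprefix; elim: B {F pre preE} => //= a B IHB.
    exact: (computes_addc (2 * a.1 + a.2).+1 (computes_mulc (2 * n) IHB)).
  apply: computes_prim IHBs hP _ _ => [[//|x []]//|[//|x []]// m _ /=].
  by rewrite preE /F /= catA.
refine (computes_ext _ (computes_comp2 FP (computes_proj 1 0) (computes_proj 1 0))).
by case.
Qed.

(** Minimisation searches for an exponent [m] such that the input is the code of the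
    [m]-th power of one of the finitely many block lists: the product of the
    distances to these codes vanishes. *)
Lemma block_powers_enumerable (S : set (seq (word 'I_n))) : finite_set S ->
  recursively_enumerable [set word_code w | w in block_powers S].
Proof.
move=> /finite_seqP[s ->].
pose dist Bs := let p := RComp (rpowers Bs) [:: RProj 0] in
  radd (rsub p (RProj 1)) (rsub (RProj 1) p).
pose test := foldr (fun Bs f => rmul (dist Bs) f) (rsucc RZero) s.
pose D Bs y x := let p := word_code (block_power y Bs) in (p - x + (x - p))%N.
pose T y x := foldr (fun Bs z => D Bs y x * z)%N 1%N s.
have testP : computes 2 test (fun xs => T (nth 0%N xs 0) (nth 0%N xs 1)).
  rewrite /test /T; elim: s {test T} => [|Bs s IHs] /=.
    exact: computes_succ (computes_zero _).
  have pP := computes_comp1 (computes_powers Bs) (computes_proj 2 0).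
  have xP := computes_proj 2 1.
  exact: (computes_mul (computes_add (computes_sub pP xP) (computes_sub xP pP)) IHs).
have T0 y x : T y x = 0%N <-> exists2 Bs, Bs \in s & x = word_code (block_power y Bs).
  rewrite /T; elim: s {test T testP} => [|Bs s IHs] /=; first by split=> [|[]].
  split=> [/eqP|[Bs' + ex]].
    rewrite muln_eq0 addn_eq0 !subn_eq0 -eqn_leq => /orP[/eqP <-|/eqP/IHs[Bs' Bs's ->]].
      by exists Bs; rewrite ?mem_head.
    by exists Bs'; rewrite // inE Bs's orbT.
  rewrite inE => /orP[/eqP e|Bs's]; first by rewrite /D -e -ex subnn.
  by have -> := proj2 IHs (ex_intro2 _ _ Bs' Bs's ex); rewrite muln0.
exists (RMu test) => x; split=> [[w [Bs [m [Bss ->]]] <-]|[y [+ _]]].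
  have ex0 : exists y, T y (word_code (block_power m Bs)) == 0%N.
    by exists m; apply/eqP/T0; exists Bs.
  exists (ex_minn ex0); case: ex_minnP => y /eqP Ty y_min; split.
    by apply/testP.
  move=> z zy; set t := T z (word_code (block_power m Bs)).
  exists t.-1; apply/testP => //=; rewrite prednK // lt0n.
  by apply: contraTneq zy => /eqP /y_min; rewrite -leqNgt.
move=> /(proj1 (testP [:: y; x] erefl 0%N)) /esym /T0[Bs Bss /= ex].
by rewrite ex; exists (block_power y Bs) => //; exists Bs, y.
Qed.

End PowersEnumerable.
Lemma commutator_eq1 (G : groupType) (x y : G) :
  x * (y * (x^-1 * y^-1)) = 1 <-> commute x y.
Proof. by rewrite -invgM mulgA; split=> [/divg1_eq|->]; rewrite ?mulgV. Qed.

(** * Finite and recursive presentations of Bestvina-Brady groups *)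

Lemma connected_paths (L : scomplex) (k0 : L) : connected L ->
  exists path_to : L -> seq L,
    forall u, edge_path k0 (path_to u) /\ last k0 (path_to u) = u.
Proof.
move=> [_ L_conn].
have /choice[f fP] : forall u, exists s, edge_path k0 s /\ last k0 s = u.
  by move=> u; have [s] := L_conn k0 u; exists s.
by exists f.
Qed.

Section SimplyConnected.
Variables (K : scomplex) (k0 : K).
Hypotheses (K_sc : simply_connected K) (K_fin : finite_set [set: K]).

Definition edge_word (u v : K) : word K := [:: (u, false); (v, true)].

Definition edge_commutator (t : K * K * K) : word K :=
  let e := edge_word t.1.1 t.1.2 in let f := edge_word t.1.2 t.2 in
  e ++ f ++ winv e ++ winv f.

Definition triangle_relators : set (word K) :=
  [set [:: (k0, true)]] `|`
  edge_commutator @` [set t | simplex [fset t.1.1; t.1.2; t.2]%fset].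

Lemma triangle_relators_finite : finite_set triangle_relators.
Proof.
rewrite finite_setU; split; first exact: finite_set1.
apply/finite_image/(sub_finite_set (@subsetT _ _)).
have -> : [set: K * K * K] = ([set: K] `*` [set: K]) `*` [set: K].
  by apply/seteqP; split.
by do !apply: finite_setX.
Qed.

Lemma triangle_relators_hold r :
  triangle_relators r -> weval (bb_gen_val k0) r = 1.
Proof.
move=> [->|[[[u v] w] /= uvw <-]]; first by rewrite /= mulg1 /letter_val /= /bb_gen_val mulgV.
have edge a b : a \in [fset u; v; w]%fset -> b \in [fset u; v; w]%fset ->
    commute (raag_gen a) (raag_gen b).
  move=> aS bS; apply: raag_gen_commute; apply: simplexS uvw.
    by rewrite fsubUset !fsub1set aS bS.
  by apply/fset0Pn; exists a; rewrite !inE eqxx.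
rewrite /edge_commutator !weval_cat !weval_winv /= !mulg1 /letter_val /=.
rewrite !bb_gen_edge; apply/commutator_eq1.
have edge_uv a : a \in [fset u; v; w]%fset ->
    commute (raag_gen u / raag_gen v) (raag_gen a).
  move=> aS; apply/commute_sym/commuteM; last apply/commuteV.
    by apply: edge; rewrite // !inE eqxx.
  by apply: edge; rewrite // !inE eqxx orbT.
apply: commuteM; last apply/commuteV.
  by apply: edge_uv; rewrite // !inE eqxx orbT.
by apply: edge_uv; rewrite // !inE eqxx orbT.
Qed.

Let y := pres_gen triangle_relators.

Lemma triangle_edge_commute (u v w : K) : simplex [fset u; v; w]%fset ->
  commute ((y u)^-1 * y v) ((y v)^-1 * y w).
Proof.
move=> uvw; have : pres_class triangle_relators (edge_commutator (u, v, w)) = 1.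
  by apply: pres_class_rel; right; exists (u, v, w).
rewrite pres_classE /edge_commutator !weval_cat !weval_winv /= !mulg1.
by rewrite /letter_val /= => /commutator_eq1.
Qed.

(** Commutation of the edges of a triangle makes the power of the third edge the
    product of the powers of the first two. *)
Lemma path_power_homotopic h x s t :
  homotopic x s t -> path_power y h x s = path_power y h x t.
Proof.
elim=> [//|//|? ? ? _ -> _ -> //|a b|a v w b avw].
  by rewrite !path_power_cat /= mulVg one_zexp mul1g.
rewrite !path_power_cat /= [zexp _ _ * (_ * _)]mulgA -zexpM.
  by rewrite [_^-1 * _ * (_^-1 * _)]mulgA mulgK.
exact: triangle_edge_commute.
Qed.

(** The chosen path to [v] and the one through [u] are homotopic. *)
Theorem bb_finitely_presented : finitely_presented (BB K).
Proof.
have [path_to path_toP] := connected_paths k0 K_sc.1.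
have y0 : y k0 = 1 by apply: pres_class_rel; left.
have edgeP u v h : adjacent u v -> path_power y h k0 (path_to v) =
    path_power y h k0 (path_to u) * zexp ((y u)^-1 * y v) h.
  move=> [_ uv]; have [[ku lu] [kv lv]] := (path_toP u, path_toP v).
  have kuv : edge_path k0 (path_to u ++ [:: v]).
    by apply/edge_path_cat; rewrite lu.
  rewrite (@path_power_homotopic h _ _ (path_to u ++ [:: v])).
    by rewrite path_power_cat /= lu mulg1.
  by apply: simply_connected_homotopic => //; rewrite lv last_cat.
apply: (@finitely_presentedI _ triangle_relators _ (bb_gen k0)) => //.
- exact: triangle_relators_finite.
- exact/bb_gen_relators/triangle_relators_hold.
- exact: (bb_gen_surj path_toP triangle_relators_hold).
- exact: (bb_gen_faithful path_toP y0 edgeP).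
Qed.

End SimplyConnected.

Section Recursive.
Variables (L : scomplex) (k0 : L).
Hypothesis L_fin : finite_set [set: L].
Variable path_to : L -> seq L.
Hypothesis path_toP : forall u, edge_path k0 (path_to u) /\ last k0 (path_to u) = u.

(** The edges of a path, or their inverses, as words in the generators [y_u]. *)
Fixpoint path_blocks (b : bool) (x : L) (s : seq L) : seq (word L) :=
  if s is z :: s' then
    (if b then [:: (x, false); (z, true)] else [:: (z, false); (x, true)])
      :: path_blocks b z s'
  else [::].

Definition signed (b : bool) (m : nat) : int := if b then Posz m else (- Posz m)%R.

Lemma zexp_signed (G : groupType) (x : G) b m :
  zexp x (signed b m) = (if b then x else x^-1) ^+ m.
Proof. by case: b m => [|] [|m] //=; rewrite expVgn. Qed.

Lemma weval_path_blocks (G : groupType) (y : L -> G) b m x s :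
  weval y (block_power m (path_blocks b x s)) = path_power y (signed b m) x s.
Proof.
rewrite /block_power; elim: s x => //= z s IHs x.
rewrite weval_cat weval_nseq IHs zexp_signed; congr (_ ^+ _ * _).
by case: b {IHs}; rewrite /= mulg1 /letter_val //= invgM invgK.
Qed.

Definition edge_loop (u v : L) : seq L :=
  path_to u ++ v :: rev (belast k0 (path_to v)).

Definition loop_blocks : set (seq (word L)) :=
  [set [:: [:: (k0, true)]]] `|`
  (fun t => path_blocks t.2 k0 (edge_loop t.1.1 t.1.2)) @`
    [set t : L * L * bool | adjacent t.1.1 t.1.2].

Lemma loop_blocks_finite : finite_set loop_blocks.
Proof.
rewrite finite_setU; split; first exact: finite_set1.
apply/finite_image/(sub_finite_set (@subsetT _ _)).
have -> : [set: L * L * bool] = ([set: L] `*` [set: L]) `*` [set: bool].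
  by apply/seteqP; split.
by do !apply: finite_setX.
Qed.

Lemma edge_loopP u v : adjacent u v ->
  edge_path k0 (edge_loop u v) /\ last k0 (edge_loop u v) = k0.
Proof.
move=> [_ uv]; have [[ku lu] [kv lv]] := (path_toP u, path_toP v).
have := edge_path_rev kv; have := last_rev_belast k0 (path_to v); rewrite lv.
by rewrite /edge_loop last_cat /= edge_path_cat lu /=; tauto.
Qed.

Lemma loop_blocks_hold r :
  block_powers loop_blocks r -> weval (bb_gen_val k0) r = 1.
Proof.
move=> [Bs [m [[->|[[[u v] b] /= uv <-]] ->]]].
  rewrite /block_power /= cats0 weval_nseq /= mulg1.
  by rewrite /letter_val /= /bb_gen_val mulgV expg1n.
have [kl ll] := edge_loopP uv.
by rewrite weval_path_blocks path_power_raag // ll mulgV.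
Qed.

Let y := pres_gen (block_powers loop_blocks).

Lemma loop_blocks_base : y k0 = 1.
Proof.
apply: pres_class_rel; exists [:: [:: (k0, true)]], 1%N.
by split=> //; left.
Qed.

(** The relator is the [h]-th power of the loop through the edge from [u] to [v]. *)
Lemma loop_blocks_edge u v h : adjacent u v -> path_power y h k0 (path_to v) =
  path_power y h k0 (path_to u) * zexp ((y u)^-1 * y v) h.
Proof.
move=> uv; have [b [m ->]] : exists b m, h = signed b m.
  by case: h => m; [exists true, m | exists false, m.+1; rewrite NegzE].
have : weval y (block_power m (path_blocks b k0 (edge_loop u v))) = 1.
  rewrite -pres_classE; apply: pres_class_rel.
  exists (path_blocks b k0 (edge_loop u v)), m; split=> //; right.
  by exists (u, v, b).
have := path_power_rev y (signed b m) k0 (path_to v); rewrite (path_toP v).2.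
rewrite weval_path_blocks /edge_loop path_power_cat /= (path_toP u).2 => ->.
by rewrite mulgA => /divg1_eq <-.
Qed.

Lemma bb_recursive : recursively_presented (BB L).
Proof.
have [n [e [c [eK cK]]]] := finite_enum L_fin.
exists n, (relabel c @` block_powers loop_blocks); split.
  have -> : relabel c @` block_powers loop_blocks =
      block_powers ((fun Bs => [seq relabel c B | B <- Bs]) @` loop_blocks).
    apply/seteqP; split=> [_ [_ [Bs [m [BsL ->]]] <-]|_ [_ [m [[Bs BsL <-] ->]]]].
      exists [seq relabel c B | B <- Bs], m; split; first by exists Bs.
      exact: block_power_map.
    exists (block_power m Bs); first by exists Bs, m.
    exact: block_power_map.
  exact/block_powers_enumerable/finite_image/loop_blocks_finite.
apply: (relabel_isomorphic eK cK (x := bb_gen k0)).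
- exact/bb_gen_relators/loop_blocks_hold.
- exact: (bb_gen_surj path_toP loop_blocks_hold).
- exact: (bb_gen_faithful path_toP loop_blocks_base loop_blocks_edge).
Qed.

End Recursive.

Theorem bb_recursively_presented (L : scomplex) :
  connected L -> finite_set [set: L] -> recursively_presented (BB L).
Proof.
move=> L_conn L_fin; have [k0 _] := L_conn.1.
have [path_to path_toP] := connected_paths k0 L_conn.
exact: (bb_recursive L_fin path_toP).
Qed.
(** * Reduced words in right-angled Artin groups *)

Section ReducedWords.
Variable L : scomplex.
Implicit Types (a b : L * bool) (w v : word L).

Definition inv_letter a : L * bool := (a.1, ~~ a.2).

Definition comm_letter a b : bool := `[< adjacent a.1 b.1 >].

Lemma inv_letterK : involutive inv_letter.
Proof. by case=> x b; rewrite /inv_letter /= negbK. Qed.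

Lemma comm_letterC a b : comm_letter a b = comm_letter b a.
Proof.
by apply/asboolP/asboolP => -[nab sab]; split; [exact: nesym|rewrite fsetUC|
  exact: nesym|rewrite fsetUC].
Qed.

Lemma comm_letterNl a b : comm_letter (inv_letter a) b = comm_letter a b.
Proof. by []. Qed.

Lemma comm_letter_neq a b : comm_letter a b -> a.1 != b.1.
Proof. by move=> /asboolP[/eqP]. Qed.

Lemma comm_letter_val a b : comm_letter a b ->
  commute (letter_val (@raag_gen L) a) (letter_val (@raag_gen L) b).
Proof.
move=> /asboolP[_ /raag_gen_commute ab]; rewrite /letter_val.
case: a.2 b.2 => [] [] //; first exact: commuteV.
  exact/commute_sym/commuteV/commute_sym.
exact/commuteV/commute_sym/commuteV/commute_sym.
Qed.

Lemma letter_val_inv (G : groupType) (x : L -> G) a :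
  letter_val x (inv_letter a) = (letter_val x a)^-1.
Proof. by case: a => u b; apply: letter_valN. Qed.

Lemma raag_class_cons a w :
  raag_class (a :: w) = letter_val (@raag_gen L) a * raag_class w.
Proof. by rewrite !raag_classE. Qed.

(** The word obtained by deleting the first occurrence of [a] that can be moved
    to the front by commutations. *)
Fixpoint strip a w : option (word L) :=
  if w is b :: w' then
    if b == a then Some w'
    else if comm_letter a b then omap (cons b) (strip a w') else None
  else None.

Inductive trace_eq : word L -> word L -> Prop :=
| trace_nil : trace_eq [::] [::]
| trace_cons a w v : trace_eq w v -> trace_eq (a :: w) (a :: v)
| trace_swap a b w : comm_letter a b -> trace_eq [:: a, b & w] [:: b, a & w]
| trace_trans w v u : trace_eq w v -> trace_eq v u -> trace_eq w u.

Lemma trace_refl w : trace_eq w w.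
Proof. by elim: w => [|a w]; [apply: trace_nil|apply: trace_cons]. Qed.

Lemma trace_sym w v : trace_eq w v -> trace_eq v w.
Proof.
elim=> [|a w' v' _|a b w' ab|w' v' u _ vw _ uv].
- exact: trace_nil.
- exact: trace_cons.
- by apply: trace_swap; rewrite comm_letterC.
- exact: trace_trans uv vw.
Qed.

Lemma trace_size w v : trace_eq w v -> size w = size v.
Proof. by elim=> //= [? ? ? _ -> //|? ? ? _ -> _ ->]. Qed.

Lemma trace_weval w v : trace_eq w v -> raag_class w = raag_class v.
Proof.
rewrite !raag_classE; elim=> //= [? ? ? _ ->|a b u ab|? ? ? _ -> _ ->] //.
by rewrite !mulgA (comm_letter_val ab).
Qed.

Lemma trace_all (p : pred (L * bool)) w v : trace_eq w v -> all p w = all p v.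
Proof.
by elim=> //= [? ? ? _ -> //|a b u _|? ? ? _ -> _ ->]; rewrite // andbCA.
Qed.

Lemma strip_trace a w w' : strip a w = Some w' -> trace_eq w (a :: w').
Proof.
elim: w w' => //= b w IHw w'; have [->|_] := eqVneq b a.
  by move=> [->]; apply: trace_refl.
case: ifP => // ab; case: (strip a w) IHw => // v /(_ v erefl) wv /= [<-].
apply: trace_trans (trace_cons b wv) _.
by apply: trace_swap; rewrite comm_letterC.
Qed.

Definition otrace_eq (o o' : option (word L)) : Prop :=
  match o, o' with
  | Some w, Some v => trace_eq w v
  | None, None => True
  | _, _ => False
  end.

Lemma otrace_cons b o o' :
  otrace_eq o o' -> otrace_eq (omap (cons b) o) (omap (cons b) o').
Proof. by case: o o' => [w|] [v|] //=; apply: trace_cons. Qed.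

Lemma trace_strip a w v : trace_eq w v -> otrace_eq (strip a w) (strip a v).
Proof.
elim=> //= [b w' v' wv IH|b c u bc|w' v' u _ + _].
- by case: ifP => // _; case: ifP => // _; apply: otrace_cons.
- have nbc : b != c by apply: contraTneq (comm_letter_neq bc) => ->; rewrite eqxx.
  have [ba|nba] := eqVneq b a.
    have [ca|nca] := eqVneq c a; first by rewrite ba ca eqxx in nbc.
    by rewrite -ba bc /=; apply: trace_refl.
  have [ca|nca] := eqVneq c a.
    by rewrite -ca comm_letterC bc /=; apply: trace_refl.
  case: (comm_letter a b); case: (comm_letter a c) => //=.
  by case: (strip a u) => //= t; apply: trace_swap.
- case: (strip a w') (strip a v') (strip a u) => [x|] [y|] [z|] //=.
  exact: trace_trans.
Qed.

Fixpoint reduced w : bool :=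
  if w is a :: w' then (strip (inv_letter a) w' == None) && reduced w' else true.

Lemma trace_reduced w v : trace_eq w v -> reduced w = reduced v.
Proof.
elim=> //= [a w' v' wv ->|a b u ab|? ? ? _ -> _ -> //].
  by have := trace_strip (inv_letter a) wv; do 2 case: strip.
have nab : (b == inv_letter a) = false.
  by apply: contraTF (comm_letter_neq ab) => /eqP ->; rewrite negbK.
have nba : (a == inv_letter b) = false.
  by apply: contraTF (comm_letter_neq ab) => /eqP ->; rewrite negbK.
rewrite nab nba comm_letterNl ab comm_letterNl comm_letterC ab.
by case: strip; case: strip => //=; rewrite ?andbF.
Qed.

(** Left multiplication by a letter on reduced words. These operations define an
    action of the right-angled Artin group on reduced words up to commutations, and
    a reduced word is the image of the empty one under itself: this yields the
    uniqueness of reduced words. *)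
Definition push a w : word L :=
  if strip (inv_letter a) w is Some w' then w' else a :: w.

Lemma reduced_push a w : reduced w -> reduced (push a w).
Proof.
rewrite /push; case E: strip => [w'|] rw; last by rewrite /= E.
by have := strip_trace E => /trace_reduced; rewrite rw /= => /esym/andP[].
Qed.

Lemma push_trace a w v : trace_eq w v -> trace_eq (push a w) (push a v).
Proof.
move=> wv; have := trace_strip (inv_letter a) wv; rewrite /push.
by do 2 case: strip => [?|] //=; move=> _; apply: trace_cons.
Qed.

Lemma reduced_strip a w w' : reduced w -> strip a w = Some w' ->
  strip (inv_letter a) w' = None.
Proof.
by move=> rw /strip_trace/trace_reduced; rewrite rw => /esym /= /andP[/eqP].
Qed.

Lemma push_inv a w : reduced w -> trace_eq (push a (push (inv_letter a) w)) w.
Proof.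
move=> rw; rewrite {2}/push inv_letterK; case E: strip => [w'|].
  rewrite /push (reduced_strip rw E); exact/trace_sym/strip_trace.
by rewrite /push /= eqxx; apply: trace_refl.
Qed.

Lemma strip_cons_comm a b w : comm_letter a b ->
  strip a (b :: w) = omap (cons b) (strip a w).
Proof.
move=> ab /=; case: eqP => [ba|_]; last by rewrite ab.
by have := comm_letter_neq ab; rewrite ba eqxx.
Qed.

Lemma push_comm a b w : comm_letter a b -> reduced w ->
  trace_eq (push a (push b w)) (push b (push a w)).
Proof.
move=> ab rw; rewrite {2 4}/push.
have ab' : comm_letter (inv_letter a) b by [].
have ba' : comm_letter (inv_letter b) a by rewrite comm_letterNl comm_letterC.
have aB : comm_letter (inv_letter b) (inv_letter a) by [].
have bA : comm_letter (inv_letter a) (inv_letter b) by [].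
case Ea: (strip (inv_letter a) w) => [wa|]; case Eb: (strip (inv_letter b) w) => [wb|].
- have := trace_strip (inv_letter b) (strip_trace Ea).
  rewrite Eb (strip_cons_comm _ aB).
  case E: (strip (inv_letter b) wa) => [t|] //= wbt.
  have := trace_strip (inv_letter a) wbt; rewrite /= eqxx.
  by rewrite /push E; case: strip.
- have := trace_strip (inv_letter b) (strip_trace Ea).
  rewrite Eb (strip_cons_comm _ aB).
  case E: (strip (inv_letter b) wa) => [t|] //= _.
  by rewrite /push (strip_cons_comm _ ab') Ea E; apply: trace_refl.
- have := trace_strip (inv_letter a) (strip_trace Eb).
  rewrite Ea (strip_cons_comm _ bA).
  case E: (strip (inv_letter a) wb) => [t|] //= _.
  by rewrite /push (strip_cons_comm _ ba') Eb E; apply: trace_refl.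
- rewrite /push (strip_cons_comm _ ab') (strip_cons_comm _ ba') Ea Eb.
  exact: trace_swap.
Qed.

Lemma push_val a w : raag_class (push a w) = raag_class (a :: w).
Proof.
rewrite /push; case E: strip => [w'|] //.
rewrite raag_class_cons (trace_weval (strip_trace E)) raag_class_cons.
by rewrite letter_val_inv mulgA mulgV mul1g.
Qed.

Definition act_word w v : word L := foldr push v w.

Lemma act_word_cat w w' v : act_word (w ++ w') v = act_word w (act_word w' v).
Proof. exact: foldr_cat. Qed.

Lemma reduced_act w v : reduced v -> reduced (act_word w v).
Proof. by move=> rv; elim: w => //= a w; apply: reduced_push. Qed.

Lemma act_word_trace w v v' :
  trace_eq v v' -> trace_eq (act_word w v) (act_word w v').
Proof. by move=> vv'; elim: w => //= a w; apply: push_trace. Qed.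

Lemma act_word_eq w w' : pres_eq (@raag_relators L) w w' ->
  forall v, reduced v -> trace_eq (act_word w v) (act_word w' v).
Proof.
elim=> [? v _|? ? _ IH v rv|? ? ? _ IH1 _ IH2 v rv|u x b t v rv|u r t rR v rv].
- exact: trace_refl.
- exact/trace_sym/IH.
- exact: trace_trans (IH1 v rv) (IH2 v rv).
- rewrite !act_word_cat /=; apply: act_word_trace.
  have /(push_inv (x, b)) := reduced_act t rv; exact.
- rewrite !act_word_cat; apply: act_word_trace.
  have [y [z [yz ->]]] := rR; move: (reduced_act t rv) => /=.
  set s := act_word t v => rs.
  have yzb (e e' : bool) : comm_letter (y, e) (z, e') by apply/asboolP.
  have rp c : reduced (push c s) by apply: reduced_push.
  apply: trace_trans (push_trace (y, true) (push_comm _ (rp (z, false)))) _.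
    by rewrite comm_letterC yzb.
  apply: trace_trans (push_inv (y, true) (reduced_push _ (rp _))) _.
  exact: (push_inv (z, true) rs).
Qed.

Definition normal_form w : word L := act_word w [::].

Lemma reduced_normal w : reduced (normal_form w).
Proof. exact: reduced_act. Qed.

Lemma normal_val w : raag_class (normal_form w) = raag_class w.
Proof.
by elim: w => //= a w IHw; rewrite push_val !raag_class_cons IHw.
Qed.

Lemma normal_reduced w : reduced w -> normal_form w = w.
Proof.
by elim: w => //= a w IHw /andP[/eqP s0 /IHw]; rewrite /normal_form /= => ->;
  rewrite /push s0.
Qed.

Theorem reduced_uniq w v : reduced w -> reduced v ->
  raag_class w = raag_class v -> trace_eq w v.
Proof.
move=> rw rv /raag_class_eqP/act_word_eq/(_ [::] isT).
by rewrite -!/(normal_form _) !normal_reduced.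
Qed.

Lemma reduced_neq1 w : reduced w -> raag_class w = 1 -> w = [::].
Proof.
by move=> rw w1; apply/size0nil/(@trace_size _ [::])/reduced_uniq.
Qed.

(** ** Torsion *)

(** The condition under which the powers of a reduced word are reduced: no letter
    can be moved to the end while its inverse can be moved to the front. *)
Definition cyclically_reduced w := forall w1 a w2,
  w = w1 ++ a :: w2 -> all (comm_letter a) w2 -> strip (inv_letter a) w = None.

Lemma strip_cat a w v : strip a w = None ->
  all (comm_letter a) w \/ strip a (w ++ v) = None.
Proof.
elim: w => [|b w IHw] /=; first by left.
case: ifP => // _; case: ifP => [ab|_ _]; last by right.
case E: (strip a w) => //= _; have [->|->] := IHw E; first by left.
by right.
Qed.

Lemma strip_all_cat a w v : all (comm_letter a) w ->
  strip a (w ++ v) = omap (cat w) (strip a v).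
Proof.
elim: w => [|b w IHw]; first by rewrite /=; case: strip.
move=> /andP[ab aw].
by rewrite cat_cons (strip_cons_comm _ ab) IHw //; case: strip.
Qed.

Lemma strip_power w n a : strip a w = None -> a.1 \in [seq b.1 | b <- w] ->
  strip a (flatten (nseq n w)) = None.
Proof.
move=> aw aIw; case: n => //= n; have [aw'|//] := strip_cat (flatten (nseq n w)) aw.
have /mapP[b bw ab] := aIw.
by have := allP aw' b bw => /comm_letter_neq; rewrite ab eqxx.
Qed.

(** A cancellation in a power would pair a letter [a] with an inverse letter, all
    letters between them commuting with [a]. These cannot include a whole copy of
    [w], which contains [a]; so [a] could be moved to the end of [w] and its inverse
    to the front. *)
Lemma reduced_power w n : reduced w -> cyclically_reduced w ->
  reduced (flatten (nseq n w)).
Proof.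
move=> rw cw; elim: n => //= n IHn.
have H w1 w2 : w = w1 ++ w2 -> reduced (w2 ++ flatten (nseq n w)).
  elim: w2 w1 => //= a w2 IHw2 w1 ew.
  rewrite (IHw2 (rcons w1 a)) ?cat_rcons // andbT.
  have : reduced (a :: w2).
    move: rw; rewrite ew; elim: (w1) => //= b t IHt /andP[_]; exact: IHt.
  move=> /= /andP[/eqP s0 _].
  have [aw2|->//] := strip_cat (flatten (nseq n w)) s0.
  rewrite strip_all_cat // strip_power //; first exact: (cw _ _ _ ew).
  by rewrite ew map_cat mem_cat /= inE eqxx orbT.
exact: (H [::]).
Qed.

Lemma strip_cat_Some a w v w' : strip a (w ++ v) = Some w' ->
  (exists2 w1, strip a w = Some w1 & w' = w1 ++ v) \/ all (comm_letter a) w.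
Proof.
elim: w w' => [|b w IHw] w' /=; first by right.
case: ifP => [_ [<-]|_]; first by left; exists w.
case: ifP => // ab; case E: strip => [t|] //= [<-].
have [[w1 -> ->]|->] := IHw _ E; first by left; exists (b :: w1).
by right.
Qed.

(** If [a] can be moved to the end and its inverse to the front, conjugating by [a]
    deletes both. *)
Lemma conjugate_cyclically_reduced w : exists (g : raag L) v,
  [/\ reduced v, cyclically_reduced v & raag_class w = raag_class v ^ g].
Proof.
have [n] := ubnP (size (normal_form w)); elim: n w => // n IHn w sw.
have [cw|] := pselect (cyclically_reduced (normal_form w)).
  exists 1, (normal_form w); split=> //; first exact: reduced_normal.
  by rewrite normal_val conjg1.
move=> /existsNP[w1 /existsNP[a /existsNP[w2 /not_implyP[ew /not_implyP[aw2]]]]].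
case E: strip => [t|] // _.
have [[u1 Eu _]|] : (exists2 u, strip (inv_letter a) w1 = Some u & t = u ++ a :: w2)
    \/ all (comm_letter (inv_letter a)) w1.
  by apply: strip_cat_Some; rewrite -ew.
  have val_w2 : letter_val (@raag_gen L) a * raag_class w2 =
      raag_class w2 * letter_val (@raag_gen L) a.
    elim: w2 aw2 {ew E} => [_|b v IHv /= /andP[ab av]].
      by rewrite raag_classE /= mulg1 mul1g.
    by rewrite raag_class_cons mulgA (comm_letter_val ab) -!mulgA IHv.
  have [|g [v [rv cv ev]]] := IHn (u1 ++ w2).
    apply: leq_trans (_ : (size u1 + size w2).+1 <= n)%N => //.
      rewrite ltnS -size_cat; elim: (u1 ++ w2) => //= b u IHu.
      rewrite /push; case Es: strip => [u'|]; last exact: IHu.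
      have := trace_size (strip_trace Es); rewrite /normal_form in IHu *.
      by move=> /= es; rewrite -/(act_word u [::]) es in IHu; lia.
    have := trace_size (strip_trace Eu) => /= e1; move: sw; rewrite ew size_cat /=; lia.
  exists (g * letter_val (@raag_gen L) a), v; split=> //.
  rewrite conjgM -ev -normal_val ew !raag_class_cat.
  rewrite (trace_weval (strip_trace Eu)) !raag_class_cons letter_val_inv val_w2.
  by rewrite conjgE !mulgA.
move=> aw1; move: E; rewrite ew strip_all_cat //=; case: ifP => [/eqP|_].
  by case: (a) => x []. 
by case: ifP => // /comm_letter_neq; rewrite eqxx.
Qed.

(** The powers of a non-empty cyclically reduced word are reduced and non-empty. *)
Theorem raag_torsion_free (x : raag L) : finite_order x -> x = 1.
Proof.
move=> [n n_gt0 xn]; have [w ew] := raag_class_surj x.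
have [g [v [rv cv ev]]] := conjugate_cyclically_reduced w.
suff v0 : v = [::] by rewrite ew ev v0 raag_classE /= conj1g.
have vn : raag_class (flatten (nseq n v)) = 1.
  rewrite raag_classE weval_nseq -raag_classE; apply/eqP.
  by rewrite -(conjg_eq1 _ g) conjXg -ev -ew xn.
have := reduced_neq1 (reduced_power n rv cv) vn.
by case: n n_gt0 {xn vn} => //= n _; case: v {rv cv ev}.
Qed.

End ReducedWords.

Lemma bb_torsion_free (L : scomplex) (x : BB L) : finite_order x -> x = 1.
Proof.
move=> [n n_gt0 xn]; apply/val_inj/raag_torsion_free; exists n => //.
by rewrite -(morph_exp (@valM _ _ (BB L))) xn.
Qed.
(** * Last letters and the holonomy cocycle *)

Section LastLetters.
Variable L : scomplex.
Implicit Types (a : L * bool) (w v : word L) (g : raag L).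

(** The vertices of the letters that can be moved to the end of a word. *)
Fixpoint last_vertices w : seq L :=
  if w is a :: w' then
    if all (comm_letter a) w' then a.1 :: last_vertices w' else last_vertices w'
  else [::].

Lemma last_vertices_sub w x : x \in last_vertices w -> x \in [seq a.1 | a <- w].
Proof.
elim: w => //= a w IHw; rewrite inE; case: ifP => _; rewrite ?inE.
  by move=> /orP[->//|/IHw ->]; rewrite orbT.
by move=> /IHw ->; rewrite orbT.
Qed.

Lemma last_vertices_clique w x z : x \in last_vertices w ->
  z \in last_vertices w -> x <> z -> adjacent x z.
Proof.
elim: w => //= a w IHw; case: ifP => // aw.
have adj u : u \in last_vertices w -> adjacent a.1 u.
  by move=> /last_vertices_sub/mapP[c cw ->]; have /asboolP := allP aw c cw.
rewrite !inE => /orP[/eqP->|xw] /orP[/eqP->|zw] nxz //.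
- exact: adj.
- by have [nax sax] := adj x xw; split; [exact: nesym | rewrite fsetUC].
- exact: IHw.
Qed.

Lemma last_vertices_trace w v : trace_eq w v -> last_vertices w =i last_vertices v.
Proof.
elim=> //= [a w' v' wv IH x|a b u ab x|? ? ? _ IH1 _ IH2 x].
- by rewrite (trace_all _ wv); case: ifP => _; rewrite ?inE IH.
- rewrite ab comm_letterC ab /=; case: ifP => _; case: ifP => _; rewrite ?inE //.
  by rewrite orbCA.
- by rewrite IH1 IH2.
Qed.

Lemma last_vertices_cons a w : {subset last_vertices w <= last_vertices (a :: w)}.
Proof. by move=> x xw /=; case: ifP => // _; rewrite inE xw orbT. Qed.

Lemma last_vertices_neq0 w : w != [::] -> last_vertices w != [::].
Proof.
elim: w => //= a [|b w] //= IHw _; have := IHw isT.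
by case: ifP => //; case: ifP.
Qed.

Definition last_of g : seq L := last_vertices (normal_form (rep g)).

Lemma last_of_class w : last_of (raag_class w) =i last_vertices (normal_form w).
Proof.
apply/last_vertices_trace/reduced_uniq; rewrite ?reduced_normal // !normal_val.
exact: repK.
Qed.

Lemma last_of_reduced w : reduced w -> last_of (raag_class w) =i last_vertices w.
Proof. by move=> rw x; rewrite last_of_class normal_reduced. Qed.

Lemma last_of_neq0 g : g <> 1 -> last_of g != [::].
Proof.
move=> g1; apply: last_vertices_neq0; apply/eqP => e; case: g1.
by rewrite -(repK g) -[class_of _]normal_val e raag_classE.
Qed.

Lemma last_of_clique g x z :
  x \in last_of g -> z \in last_of g -> x <> z -> adjacent x z.
Proof. exact: last_vertices_clique. Qed.

Let val_of a : raag L := letter_val (@raag_gen L) a.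

(** Multiplying on the left by a letter either lengthens the reduced word, which
    adds to the set of last letters, or shortens it. *)
Lemma last_of_letter a g :
  {subset last_of g <= last_of (val_of a * g)} \/
  {subset last_of (val_of a * g) <= last_of g}.
Proof.
have [w ew] := raag_class_surj g; have rw := reduced_normal w.
rewrite -normal_val in ew; move: (normal_form w) rw ew => {}w rw ->.
rewrite -raag_class_cons -push_val; have rp := reduced_push a rw.
move: rp; rewrite /push; case E: strip => [w'|] rp.
  right=> x; rewrite !last_of_reduced // => xw'.
  by rewrite (last_vertices_trace (strip_trace E)); apply: last_vertices_cons.
by left=> x; rewrite !last_of_reduced // => xw; apply: last_vertices_cons.
Qed.

(** In a square, the corner of greatest length has the last letters of the three
    others, since prefixing a letter can only add last letters. *)
Lemma last_of_top a b w : comm_letter a b -> reduced [:: a, b & w] ->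
  forall v, v \in [:: w; a :: w; b :: w; [:: a, b & w]] ->
  {subset last_of (raag_class v) <= last_of (raag_class [:: a, b & w])}.
Proof.
move=> ab rabw v vI.
have swap : trace_eq [:: a, b & w] [:: b, a & w] by apply: trace_swap.
have raw : reduced (a :: w).
  by move: rabw; rewrite (trace_reduced swap) => /andP[].
have rbw : reduced (b :: w) by move: rabw => /andP[].
have rv : reduced v.
  by move: vI; rewrite !inE => /or4P[] /eqP -> //; case/andP: rbw.
move=> x; rewrite !last_of_reduced //; move: vI; rewrite !inE.
move=> /or4P[] /eqP -> xv //.
- by do 2 apply: last_vertices_cons.
- by rewrite (last_vertices_trace swap); apply: last_vertices_cons.
- exact: last_vertices_cons.
Qed.

(** Each of the two letters lengthens or shortens all words of the square at once,
    so one corner is the longest; the four cases say which. *)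
Lemma last_of_square a b g : comm_letter a b ->
  exists k, forall h, h \in [:: g; val_of a * g; val_of b * g;
                                val_of a * (val_of b * g)] ->
    {subset last_of h <= last_of k}.
Proof.
move=> ab; have [w ew] := raag_class_surj g; have rw := reduced_normal w.
rewrite -normal_val in ew; move: (normal_form w) rw ew => {}w rw ->.
have commv c e h : comm_letter c e ->
    val_of c * (val_of e * h) = val_of e * (val_of c * h).
  by move=> ce; rewrite !mulgA (comm_letter_val ce).
have invv c h : val_of c * (val_of (inv_letter c) * h) = h.
  by rewrite /val_of letter_val_inv mulVKg.
have ab' : comm_letter (inv_letter a) b by [].
have ba' : comm_letter (inv_letter b) a by rewrite comm_letterNl comm_letterC.
have aB : comm_letter a (inv_letter b) by [].
have Ba : comm_letter (inv_letter b) (inv_letter a) by rewrite comm_letterC.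
have AB : comm_letter (inv_letter a) (inv_letter b) by [].
have redE c u : reduced (c :: u) = (strip (inv_letter c) u == None) && reduced u.
  by [].
have top c e u (s : seq (raag L)) : comm_letter c e -> reduced [:: c, e & u] ->
    {subset s <= [:: raag_class u; val_of c * raag_class u; val_of e * raag_class u;
      val_of c * (val_of e * raag_class u)]} ->
    exists k, forall h', h' \in s -> {subset last_of h' <= last_of k}.
  move=> ce rceu sub; exists (raag_class [:: c, e & u]) => h' /sub.
  rewrite -!raag_class_cons !inE => /or4P[] /eqP ->; apply: last_of_top => //;
    by rewrite !inE eqxx ?orbT.
case Ea: (strip (inv_letter a) w) => [wa|]; last first.
  case Eb: (strip (inv_letter b) w) => [wb|]; last first.
    by apply: (top a b w); rewrite // !redE (strip_cons_comm _ ab') Ea Eb.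
  have wwb := strip_trace Eb; have := trace_strip (inv_letter a) wwb.
  rewrite Ea (strip_cons_comm _ AB); case E: (strip (inv_letter a) wb) => //= _.
  apply: (top a (inv_letter b) wb) => //.
    by rewrite redE (strip_cons_comm _ AB) E /= -redE -(trace_reduced wwb).
  rewrite (trace_weval wwb) raag_class_cons -!/(val_of _) invv.
  by move=> h; rewrite !inE; do 4 case: eqP.
have wwa := strip_trace Ea; have := trace_strip (inv_letter b) wwa.
rewrite (strip_cons_comm _ Ba).
case Eb: (strip (inv_letter b) w) => [wb|]; case E: (strip (inv_letter b) wa) => [t|] //= _.
  have wat := strip_trace E.
  apply: (top (inv_letter a) (inv_letter b) t) => //.
    by rewrite -(trace_reduced (trace_cons (inv_letter a) wat)) -(trace_reduced wwa).
  rewrite (trace_weval wwa) (trace_weval (trace_cons _ wat)) !raag_class_cons.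
  rewrite -!/(val_of _) (commv b (inv_letter a)) 1?comm_letterC // !invv.
  by move=> h; rewrite !inE; do 4 case: eqP.
apply: (top (inv_letter a) b wa) => //.
  rewrite (@trace_reduced _ _ [:: b, inv_letter a & wa]); last exact: trace_swap.
  by rewrite redE (strip_cons_comm _ Ba) E /= -redE -(trace_reduced wwa).
rewrite (trace_weval wwa) raag_class_cons -!/(val_of _).
rewrite (commv b (inv_letter a)) 1?comm_letterC // !invv.
by move=> h; rewrite !inE; do 4 case: eqP.
Qed.

End LastLetters.
Section Height.
Variable L : scomplex.

Definition hgt (g : raag L) : int := exponent_sum (rep g).

Lemma hgt_class (w : word L) : hgt (raag_class w) = exponent_sum w.
Proof. exact: height_class. Qed.

Lemma hgtM (g h : raag L) : hgt (g * h) = (hgt g + hgt h)%R.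
Proof. exact: heightM. Qed.

Lemma hgt1 : hgt 1 = 0%R.
Proof. exact: height1. Qed.

Lemma hgt_BB (x : BB L) : hgt (val x) = 0%R.
Proof. exact/eqP/(valP x). Qed.

End Height.

Section Holonomy.
Variables (L : scomplex) (x0 : L) (path_to : L -> seq L).
Hypothesis L_flag : flag L.
Hypothesis path_toP : forall u, edge_path x0 (path_to u) /\ last x0 (path_to u) = u.
Implicit Types (s t : seq L) (u v : L) (g h : raag L).

Let back v := rev (belast x0 (path_to v)).

Let backP v : edge_path v (back v) /\ last v (back v) = x0.
Proof.
have [pv lv] := path_toP v; have := edge_path_rev pv.
by have := last_rev_belast x0 (path_to v); rewrite lv.
Qed.

(** Total in the list: one that is not a loop gets the trivial class. *)
Definition loop_class s : pi1 x0 := pi1_class (insubd (loop1 x0) s).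

Let loopP s : edge_path x0 s -> last x0 s = x0 -> val (insubd (loop1 x0) s) = s.
Proof. by move=> ps ls; apply: insubdK; apply/asboolP. Qed.

Lemma loop_class_homotopic s t : edge_path x0 s -> last x0 s = x0 ->
  edge_path x0 t -> homotopic x0 s t -> loop_class s = loop_class t.
Proof.
move=> ps ls pt st; apply/class_of_eqP; rewrite /peq /= /loop_eq !loopP //.
by rewrite -(homotopic_last st).
Qed.

Lemma loop_class_cat s t : edge_path x0 s -> last x0 s = x0 ->
  edge_path x0 t -> last x0 t = x0 ->
  loop_class s * loop_class t = loop_class (s ++ t).
Proof.
move=> ps ls pt lt; rewrite /loop_class /pi1_class -class_ofM.
congr class_of; apply: val_inj; rewrite /= !loopP //.
  by rewrite edge_path_cat ls.
by rewrite last_cat ls.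
Qed.

Lemma loop_class_val (s : loop x0) : loop_class (val s) = pi1_class s.
Proof. by rewrite /loop_class valKd. Qed.

(** The path [s] from [u] is closed up by the chosen paths from the base point to
    its ends. *)
Definition path_class u s : pi1 x0 :=
  loop_class (path_to u ++ s ++ back (last u s)).

Lemma path_class_loop u s : edge_path u s ->
  edge_path x0 (path_to u ++ s ++ back (last u s)) /\
  last x0 (path_to u ++ s ++ back (last u s)) = x0.
Proof.
move=> us; have [pu lu] := path_toP u; have [pb lb] := backP (last u s).
by rewrite !edge_path_cat !last_cat lu.
Qed.

Lemma path_class_nil u : path_class u [::] = 1.
Proof.
have [pu lu] := @path_class_loop u [::] I.
rewrite /path_class (@loop_class_homotopic _ [::]) //.
  exact: (loop_class_val (loop1 x0)).
by rewrite /= /back; apply/homotopic_rev/(path_toP u).1.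
Qed.

Lemma path_class_cat u s t : edge_path u s -> edge_path (last u s) t ->
  path_class u s * path_class (last u s) t = path_class u (s ++ t).
Proof.
move=> us st; have ust : edge_path u (s ++ t) by apply/edge_path_cat.
have [[p1 l1] [p2 l2]] := (path_class_loop us, path_class_loop st).
have [p3 l3] := path_class_loop ust.
rewrite /path_class loop_class_cat //; apply: loop_class_homotopic => //.
- by rewrite edge_path_cat l1.
- by rewrite last_cat l1.
set z := last u s; rewrite last_cat -/z -!catA; apply: cat_homotopic.
rewrite (path_toP u).2; apply: cat_homotopic; rewrite -/z catA.
apply: (@homotopic_cat _ _ _ [::]).
have [pb lb] := backP z; have := homotopic_rev pb; congr homotopic; congr cat.
by rewrite /back; have := rev_belastK x0 (path_to z); rewrite (path_toP z).2.
Qed.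

Definition edge_class u v := path_class u [:: v].

Lemma edge_class_triangle u v w : simplex [fset u; v; w]%fset ->
  edge_class u v * edge_class v w = edge_class u w.
Proof.
move=> uvw; have edge a b : a \in [fset u; v; w]%fset -> b \in [fset u; v; w]%fset ->
    simplex [fset a; b]%fset.
  move=> aS bS; apply: simplexS uvw; first by rewrite fsubUset !fsub1set aS bS.
  by apply/fset0Pn; exists a; rewrite !inE eqxx.
have uv : simplex [fset u; v]%fset by apply: edge; rewrite !inE eqxx ?orbT.
have vw : simplex [fset v; w]%fset by apply: edge; rewrite !inE eqxx ?orbT.
have uw : simplex [fset u; w]%fset by apply: edge; rewrite !inE eqxx ?orbT.
rewrite /edge_class (@path_class_cat u [:: v] [:: w]) //.
have p1 : edge_path u [:: v; w] by [].
have p2 : edge_path u [:: w] by [].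
have [[q1 l1] [q2 l2]] := (path_class_loop p1, path_class_loop p2).
apply: loop_class_homotopic => //; apply: cat_homotopic.
rewrite (path_toP u).2 /=.
exact: (@homotopic_triangle _ u [::] v w).
Qed.

(** ** The cocycle *)

(** A vertex of the simplex of last letters; the default value [x0] only occurs at
    [g = 1]. *)
Definition base_vertex g : L := head x0 (last_of g).

Lemma base_vertexP g : g <> 1 -> base_vertex g \in last_of g.
Proof.
move=> /last_of_neq0; rewrite /base_vertex.
by case: (last_of g) => //= v s _; rewrite mem_head.
Qed.

Lemma last_of_simplex3 k u v w : u \in last_of k -> v \in last_of k ->
  w \in last_of k -> simplex [fset u; v; w]%fset.
Proof.
move=> uk vk wk; apply: L_flag; first by apply/fset0Pn; exists u; rewrite !inE eqxx.
have sub z : z \in [fset u; v; w]%fset -> z \in last_of k.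
  by rewrite !inE => /orP[/orP[]|] /eqP ->.
by move=> z z' /sub zk /sub; apply: last_of_clique zk.
Qed.

Let step g h := edge_class (base_vertex g) (base_vertex h).

Let step_mul k g g' h : g <> 1 -> g' <> 1 -> h <> 1 ->
  {subset last_of g <= last_of k} -> {subset last_of g' <= last_of k} ->
  {subset last_of h <= last_of k} -> step g g' * step g' h = step g h.
Proof.
move=> g1 g'1 h1 gk g'k hk; apply: edge_class_triangle.
exact: last_of_simplex3 (gk _ (base_vertexP g1)) (g'k _ (base_vertexP g'1))
  (hk _ (base_vertexP h1)).
Qed.

Let step_refl g : g <> 1 -> step g g = 1.
Proof.
move=> g1; have := @step_mul g g g g g1 g1 g1 (fun _ => id) (fun _ => id) (fun _ => id).
by move=> /(canRL (mulKg _)); rewrite mulVg.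
Qed.

(** The holonomy, in the fundamental group, of the path from [g] to
    [raag_class w * g] that follows the letters of [w] from right to left. *)
Fixpoint holonomy (w : word L) g : pi1 x0 :=
  if w is a :: w' then
    step (raag_class (a :: w') * g) (raag_class w' * g) * holonomy w' g
  else 1.

Lemma holonomy_cat w w' g :
  holonomy (w ++ w') g = holonomy w (raag_class w' * g) * holonomy w' g.
Proof.
elim: w => [|a w IHw]; rewrite ?mul1g //=.
by rewrite IHw -cat_cons !raag_class_cat !mulgA.
Qed.

Lemma hgt_neq1 g : (0 < hgt g)%R -> g <> 1.
Proof. by move=> + g1; rewrite g1 hgt1. Qed.

Lemma hgt_letter a g :
  hgt (letter_val (@raag_gen L) a * g) = (letter_sign a + hgt g)%R.
Proof.
rewrite hgtM; congr (_ + _)%R.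
have := hgt_class [:: a]; rewrite raag_classE /= mulg1 => ->.
by rewrite exponent_sum_cons exponent_sum_nil GRing.addr0.
Qed.

Lemma holonomy_cancel a g : (1 < hgt g)%R -> holonomy [:: a; inv_letter a] g = 1.
Proof.
move=> g1; rewrite /= !raag_class_cons letter_val_inv -!mulgA.
rewrite [raag_class [::]]raag_classE /= !mul1g !mulVKg ?mulg1.
set h := (letter_val _ a)^-1 * g.
have eg : letter_val (@raag_gen L) a * h = g by rewrite /h mulVKg.
have h1 : (0 < hgt h)%R.
  by move: g1; rewrite -eg hgt_letter /letter_sign; case: a.2; lia.
have nh := hgt_neq1 h1; have ng : g <> 1 by apply: hgt_neq1; lia.
have := last_of_letter a h; rewrite eg => -[sub|sub].
  by rewrite (@step_mul g) ?step_refl.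
by rewrite (@step_mul h) ?step_refl.
Qed.

Lemma holonomy_relator u v g : adjacent u v -> (2 < hgt g)%R ->
  holonomy [:: (u, true); (v, true); (u, false); (v, false)] g = 1.
Proof.
move=> uv g2; rewrite /= !raag_class_cons.
rewrite [raag_class [::]]raag_classE /= !mulg1 mul1g -!mulgA.
set U := letter_val _ (u, false); set V := letter_val _ (v, false).
have uvC (b b' : bool) : comm_letter (u, b) (v, b') by apply/asboolP.
have eU : letter_val (@raag_gen L) (v, true) * (U * (V * g)) = U * g.
  rewrite [U * (V * g)]mulgA (comm_letter_val (uvC false false)) -!mulgA.
  by rewrite -[(v, false)]/(inv_letter (v, true)) letter_val_inv mulVKg.
have eu : letter_val (@raag_gen L) (u, true) * (U * g) = g.
  by rewrite /U -[(u, false)]/(inv_letter (u, true)) letter_val_inv mulVKg.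
rewrite eU eu; have [k sub] := last_of_square g (uvC false false).
have n1 : g <> 1 by apply: hgt_neq1; lia.
have n2 : U * g <> 1 by apply: hgt_neq1; rewrite hgt_letter /letter_sign /=; lia.
have n3 : V * g <> 1 by apply: hgt_neq1; rewrite hgt_letter /letter_sign /=; lia.
have n4 : U * (V * g) <> 1.
  by apply: hgt_neq1; rewrite !hgt_letter /letter_sign /=; lia.
by rewrite !(@step_mul k) ?step_refl //; apply: sub; rewrite !inE eqxx ?orbT.
Qed.

(** A derivation involves finitely many prefixes, hence only visits bounded
    heights: started high enough, it never meets the identity. *)
Lemma holonomy_eq w w' : pres_eq (@raag_relators L) w w' ->
  exists N : nat, forall g, (Posz N < hgt g)%R -> holonomy w g = holonomy w' g.
Proof.
elim=> [v|v v' _ [N IH]|v v' v'' _ [N IH] _ [N' IH']|s x b t|s r t rR].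
- by exists 0%N.
- by exists N => g /IH.
- exists (maxn N N') => g gN; rewrite IH ?IH' //.
    by apply: Order.POrderTheory.le_lt_trans gN; rewrite lez_nat leq_maxr.
  by apply: Order.POrderTheory.le_lt_trans gN; rewrite lez_nat leq_maxl.
- exists (absz (exponent_sum t)).+2 => g gN; rewrite !holonomy_cat.
  have ht : (1 < hgt (raag_class t * g))%R by rewrite hgtM hgt_class; lia.
  rewrite (holonomy_cancel (x, b) ht) mul1g raag_class_cat.
  have -> : raag_class [:: (x, b); (x, ~~ b)] = 1.
    by apply/raag_class_eqP/(pres_cancel _ [::] x b [::]).
  by rewrite mul1g.
- exists (absz (exponent_sum t)).+3 => g gN; rewrite !holonomy_cat.
  have ht : (2 < hgt (raag_class t * g))%R by rewrite hgtM hgt_class; lia.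
  have r1 : raag_class r = 1 by apply: pres_class_rel.
  rewrite raag_class_cat r1 mul1g.
  have [u [v [uv ->]]] := rR.
  by rewrite (holonomy_relator uv ht) mul1g.
Qed.

(** ** Holonomy of powers of an edge loop *)

Definition edge_letters u v : word L := [:: (u, true); (v, false)].

(** A positive word in two letters is reduced, and its last letters are among
    these two. *)
Lemma base_vertex_edge u v i j : (0 < i + j)%N ->
  raag_gen u ^+ i * raag_gen v ^+ j <> 1 /\
  base_vertex (raag_gen u ^+ i * raag_gen v ^+ j) \in [:: u; v].
Proof.
set w : word L := nseq i (u, true) ++ nseq j (v, true) => ij.
have positive (t : word L) : all snd t -> reduced t.
  elim: t => //= a t IHt /andP[at_ tt]; rewrite IHt // andbT.
  elim: t tt {IHt} => //= b t IHt /andP[bt tt].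
  have -> : (b == inv_letter a) = false.
    by apply/eqP => e; move: bt; rewrite e /= at_.
  by case: ifP => // _; rewrite (eqP (IHt tt)).
have rw : reduced w by apply: positive; rewrite all_cat !all_nseq /= !orbT.
have ew : raag_class w = raag_gen u ^+ i * raag_gen v ^+ j.
  have gen_exp (z : L) n : raag_class (nseq n (z, true)) = raag_gen z ^+ n.
    by elim: n => [|n IHn]; [rewrite raag_classE|rewrite raag_class_cons IHn expgS].
  by rewrite /w raag_class_cat !gen_exp.
have w1 : raag_class w <> 1.
  by move=> /(reduced_neq1 rw)/(congr1 size); rewrite size_cat !size_nseq /=; lia.
rewrite -ew; split=> //; have := base_vertexP w1; rewrite last_of_reduced //.
move=> /last_vertices_sub; rewrite map_cat !map_nseq mem_cat !mem_nseq !inE.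
by move=> /orP[] /andP[_ ->]; rewrite ?orbT.
Qed.

Lemma edge_class_refl u : edge_class u u = 1.
Proof.
have := @edge_class_triangle u u u; rewrite !fsetUid => /(_ (simplex1 u)).
by move=> /(canRL (mulKg _)); rewrite mulVg.
Qed.

(** The path goes from [v ^ n] to [u ^ n] through elements [u ^ i * v ^ j] with
    [i + j] equal to [n] or [n - 1]; these avoid 1 since [1 < n]. *)
Lemma holonomy_edge u v n : simplex [fset u; v]%fset -> (1 < n)%N ->
  holonomy (flatten (nseq n (edge_letters u v))) (raag_gen v ^+ n) =
  edge_class u v.
Proof.
move=> uv n_gt1; have tri a b c : a \in [:: u; v] -> b \in [:: u; v] ->
    c \in [:: u; v] -> edge_class a b * edge_class b c = edge_class a c.
  move=> aI bI cI; apply: edge_class_triangle; apply: simplexS uv.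
    by rewrite !fsubUset !fsub1set !inE in aI bI cI *; rewrite aI bI.
  by apply/fset0Pn; exists a; rewrite !inE eqxx.
have uvC : commute (raag_gen u) (raag_gen v) by apply: raag_gen_commute.
pose F j := flatten (nseq j (edge_letters u v)).
have classF j : (j <= n)%N ->
    raag_class (F j) * raag_gen v ^+ n = raag_gen u ^+ j * raag_gen v ^+ (n - j).
  move=> jn; rewrite raag_classE weval_nseq /= mulg1 /letter_val /=.
  rewrite expgMn; last exact: commuteV.
  by rewrite expVgn -mulgA -{1}(subnKC jn) expgnDr mulKg.
have baseF j i : (0 < j + i)%N ->
    base_vertex (raag_gen u ^+ j * raag_gen v ^+ i) \in [:: u; v].
  by move=> /base_vertex_edge -/(_ u v)[].
have H j : (j <= n)%N -> holonomy (F j) (raag_gen v ^+ n) =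
    edge_class (base_vertex (raag_gen u ^+ j * raag_gen v ^+ (n - j)))
      (base_vertex (raag_gen v ^+ n)).
  elim: j => [|j IHj] jn; first by rewrite subn0 mul1g edge_class_refl.
  have -> : F j.+1 = edge_letters u v ++ F j by [].
  rewrite holonomy_cat IHj 1?ltnW //.
  rewrite classF 1?ltnW // /= !raag_class_cons [raag_class [::]]raag_classE /=.
  rewrite !mulg1 mul1g /letter_val /= /step.
  have eV : (raag_gen v)^-1 * (raag_gen u ^+ j * raag_gen v ^+ (n - j)) =
      raag_gen u ^+ j * raag_gen v ^+ (n - j.+1).
    have -> : (n - j = (n - j.+1).+1)%N by lia.
    rewrite expgS [_ ^+ j * _]mulgA -(commuteX j (commute_sym uvC)) -!mulgA.
    by rewrite mulKg.
  have eU : raag_gen u / raag_gen v * (raag_gen u ^+ j * raag_gen v ^+ (n - j)) =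
      raag_gen u ^+ j.+1 * raag_gen v ^+ (n - j.+1).
    by rewrite -mulgA eV mulgA -expgS.
  rewrite eU eV !tri //; try apply: baseF; try lia.
  by rewrite -[raag_gen v ^+ n]mul1g; apply: (@baseF 0); lia.
rewrite -/(F n) H // subnn mulg1; congr edge_class.
  have [|_] := @base_vertex_edge u u n 0; first lia.
  by rewrite mulg1 !inE orbb => /eqP.
have [|_] := @base_vertex_edge v v n 0; first lia.
by rewrite mulg1 !inE orbb => /eqP.
Qed.

(** The product of the [n]-th powers of the edges of a path from [u] to [z]; it
    takes [z ^ n] to [u ^ n]. *)
Fixpoint power_word n u s : word L :=
  if s is v :: s' then flatten (nseq n (edge_letters u v)) ++ power_word n v s'
  else [::].

Lemma power_word_class n u s : edge_path u s ->
  raag_class (power_word n u s) * raag_gen (last u s) ^+ n = raag_gen u ^+ n.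
Proof.
elim: s u => [|v s IHs] u /=; first by rewrite raag_classE /= mul1g.
move=> [uv us]; rewrite raag_class_cat -mulgA IHs //.
rewrite raag_classE weval_nseq /= mulg1 /letter_val /=.
rewrite expgMn; last exact/commuteV/raag_gen_commute.
by rewrite expVgn mulgVK.
Qed.

Lemma holonomy_power_word n u s : edge_path u s -> (1 < n)%N ->
  holonomy (power_word n u s) (raag_gen (last u s) ^+ n) = path_class u s.
Proof.
move=> us n_gt1; elim: s u us => [|v s IHs] u /=; first by rewrite path_class_nil.
move=> [uv us]; rewrite holonomy_cat power_word_class // holonomy_edge //.
by rewrite IHs // /edge_class (@path_class_cat u [:: v]).
Qed.

End Holonomy.
(** * Infinite presentability *)

Lemma finite_bound (T : choiceType) (A : set T) (P : T -> nat -> Prop) :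
  finite_set A -> (forall x m n, (m <= n)%N -> P x m -> P x n) ->
  (forall x, A x -> exists n, P x n) -> exists n, forall x, A x -> P x n.
Proof.
move=> /finite_seqP[s ->] mono; elim: s => [|x s IHs] H; first by exists 0%N.
have [|n Pn] := IHs; first by move=> z zs; apply: H; rewrite /= inE zs orbT.
have [|m Pm] := H x; first by rewrite /= mem_head.
exists (maxn m n) => z; rewrite /= inE => /orP[/eqP ->|zs].
  by apply: mono Pm; rewrite leq_maxl.
by apply: mono (Pn z zs); rewrite leq_maxr.
Qed.

Section NotFinitelyPresented.
Variables (L : scomplex) (x0 : L) (path_to : L -> seq L).
Hypotheses (L_flag : flag L) (L_fin : finite_set [set: L]).
Hypothesis path_toP : forall u, edge_path x0 (path_to u) /\ last x0 (path_to u) = u.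

Let hol := holonomy x0 path_to.

Variables (n : nat) (R : set (word 'I_n)).
Hypothesis R_fin : finite_set R.
Variable f : pres R -> BB L.
Hypotheses (fM : {morph f : x y / x * y}) (f_bij : bijective f).

Variable W : 'I_n -> word L.
Hypothesis WE : forall i, raag_class (W i) = val (f (pres_gen R i)).

Let sub (v : word 'I_n) : word L :=
  flatten [seq if a.2 then W a.1 else winv (W a.1) | a <- v].

Let sub_cat v v' : sub (v ++ v') = sub v ++ sub v'.
Proof. by rewrite /sub map_cat flatten_cat. Qed.

Let subE v : raag_class (sub v) = val (f (pres_class R v)).
Proof.
have vfM : {morph (fun g => val (f g)) : x y / x * y}.
  by move=> x y /=; rewrite fM; apply: (@valM _ _ (BB L)).
rewrite pres_classE (weval_morph _ _ vfM) raag_classE.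
elim: v => //= -[i b] v <-; rewrite /sub /= weval_cat; congr (_ * _).
by case: b; rewrite /letter_val /= ?weval_winv -raag_classE WE.
Qed.

Let eventually_eq (w w' : word L) (N : nat) : Prop :=
  forall g, (Posz N < hgt g)%R -> hol w g = hol w' g.

Let eventually_mono w w' m N : (m <= N)%N -> eventually_eq w w' m -> eventually_eq w w' N.
Proof.
by move=> mN mE g gN; apply: mE; apply: Order.POrderTheory.le_lt_trans gN.
Qed.

Let eventually w w' : raag_class w = raag_class w' -> exists N, eventually_eq w w' N.
Proof. by move=> /raag_class_eqP; apply: holonomy_eq. Qed.

Let sub_hgt v g : hgt (raag_class (sub v) * g) = hgt g.
Proof. by rewrite hgtM subE hgt_BB GRing.add0r. Qed.

Let sub1 m : pres_class R m = 1 -> raag_class (sub m) = raag_class [::].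
Proof. by move=> m1; rewrite subE m1 (morph_one fM) raag_classE. Qed.

Let sub_insert N u m v : pres_class R m = 1 -> eventually_eq (sub m) [::] N ->
  eventually_eq (sub (u ++ m ++ v)) (sub (u ++ v)) N.
Proof.
move=> m1 mN g gN; rewrite !sub_cat /hol !holonomy_cat.
rewrite -/hol mN ?sub_hgt // mul1g raag_class_cat (sub1 m1).
by rewrite [raag_class [::]]raag_classE mul1g.
Qed.

(** The relators, being finitely many, hold in the holonomy from some height on;
    all their consequences then do so from the same height on. *)
Let sub_bound : exists N : nat, forall v v', pres_eq R v v' ->
  eventually_eq (sub v) (sub v') N.
Proof.
have [r Rr|N1 relN1] := finite_bound R_fin
    (fun r m N => @eventually_mono (sub r) [::] m N).
  by apply/eventually/sub1/pres_class_rel.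
pose cancel (a : 'I_n * bool) : word 'I_n := [:: a; (a.1, ~~ a.2)].
have cancel1 a : pres_class R (cancel a) = 1.
  by case: a => i b; apply/pres_class_eqP/(pres_cancel R [::] i b [::]).
have [a _|N2 relN2] := finite_bound (@finite_finset _ [set: 'I_n * bool])
    (fun a m N => @eventually_mono (sub (cancel a)) [::] m N).
  exact/eventually/sub1/cancel1.
have N1m := leq_maxl N1 N2; have N2m := leq_maxr N1 N2.
exists (maxn N1 N2) => v v'.
elim=> [//|t t' _ IH g gN|t t' t'' _ IH _ IH' g gN|u i b t|u r t Rr].
- by rewrite IH.
- by rewrite IH // IH'.
- apply: (@sub_insert _ u (cancel (i, b))) => //.
  exact: eventually_mono N2m (relN2 (i, b) I).
- apply: sub_insert; first exact: pres_class_rel.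
  exact: eventually_mono N1m (relN1 r Rr).
Qed.

(** At a large height the word of a loop has the same holonomy as a word in the
    generators of the presentation; the latter represents 1, hence is a consequence
    of the relators. *)
Lemma loops_trivial s : edge_path x0 s -> last x0 s = x0 ->
  path_class x0 path_to x0 s = 1.
Proof.
move=> ps ls; have [N subN] := sub_bound.
have edge_in (t : L * L) : exists v : word 'I_n,
      raag_class (sub v) = raag_class (edge_letters (L := L) t.1 t.2).
  have gBB : raag_class (edge_letters t.1 t.2) \in @in_BB L.
    by rewrite inE height_class /exponent_sum !big_cons big_nil.
  pose e : BB L := Sub (raag_class (edge_letters t.1 t.2)) gBB.
  have [h _ fh] := f_bij; have [v ev] := pres_class_surj (h e).
  by exists v; rewrite subE -ev fh.
have [V VE] := choice edge_in.
have LL_fin : finite_set [set: L * L].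
  have -> : [set: L * L] = [set: L] `*` [set: L] by apply/seteqP; split.
  exact: finite_setX.
have [t _|M VM] := finite_bound LL_fin
    (fun t m N => @eventually_mono (sub (V t)) (edge_letters t.1 t.2) m N).
  exact/eventually/VE.
have hgt_gen (u : L) m : hgt (raag_gen u ^+ m) = Posz m.
  elim: m => [|m IHm]; first by rewrite hgt1.
  by rewrite expgS hgtM IHm /raag_gen hgt_class exponent_sum_cons
    exponent_sum_nil GRing.addr0 /letter_sign /= intS.
have [m [m_gt1 Nm Mm]] : exists m, [/\ 1 < m, N < m & M < m]%N.
  by exists (N + M).+2; split; lia.
pose g := raag_gen x0 ^+ m.
pose power_rel := fix power_rel (u : L) (s : seq L) : word 'I_n :=
  if s is v :: s' then flatten (nseq m (V (u, v))) ++ power_rel v s' else [::].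
have sub_flatten v : sub (flatten (nseq m v)) = flatten (nseq m (sub v)).
  by elim: (m) => //= k IHk; rewrite sub_cat IHk.
have power_relE u : raag_class (sub (power_rel u s)) = raag_class (power_word m u s) /\
    hol (sub (power_rel u s)) g = hol (power_word m u s) g.
  elim: s u {ps ls} => [|v s IHs] u; first by split.
  have [IHc IHh] := IHs v; rewrite /= sub_cat !raag_class_cat sub_flatten.
  set w := sub (power_rel v s) in IHc IHh *.
  have block k : raag_class (flatten (nseq k (sub (V (u, v))))) =
      raag_class (flatten (nseq k (edge_letters u v))).
    by rewrite !raag_classE !weval_nseq -!raag_classE VE.
  split; first by rewrite block IHc.
  rewrite /hol !holonomy_cat -/hol -IHh -IHc; congr (_ * _).
  have : hgt (raag_class w * g) = Posz m by rewrite sub_hgt hgt_gen.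
  move: (raag_class w * g) => g' hg'.
  suff pow k : hol (flatten (nseq k (sub (V (u, v))))) g' =
      hol (flatten (nseq k (edge_letters u v))) g' by apply: pow.
  have flattenS (A : word L) i : flatten (nseq i.+1 A) = A ++ flatten (nseq i A) by [].
  elim: k => [//|k IHk]; rewrite !flattenS.
  rewrite /hol !holonomy_cat -/hol IHk block; congr (_ * _).
  have VMuv : eventually_eq (sub (V (u, v))) (edge_letters u v) M := VM (u, v) I.
  rewrite VMuv //.
  have -> : hgt (raag_class (flatten (nseq k (edge_letters u v))) * g') = Posz m.
    rewrite -block -hg' hgtM; suff -> : hgt (raag_class (flatten (nseq k (sub (V (u, v)))))) = 0%R.
      by rewrite GRing.add0r.
    by rewrite raag_classE weval_nseq -raag_classE; elim: (k) => [|j IHj];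
      rewrite ?hgt1 // expgS sub_hgt.
  by rewrite ltz_nat.
have [class_eq hol_eq] := power_relE x0.
have g_class := power_word_class m ps; rewrite ls in g_class.
have rel1 : pres_class R (power_rel x0 s) = 1.
  apply: (bij_inj f_bij); apply: val_inj; rewrite -subE class_eq (morph_one fM) /=.
  by apply: (mulIg (raag_gen x0 ^+ m)); rewrite g_class mul1g.
have hs := holonomy_power_word path_toP ps m_gt1; rewrite ls in hs.
rewrite -hs -/hol -/g -hol_eq (subN _ [::]) //; first exact/pres_class_eqP.
by rewrite /g hgt_gen ltz_nat.
Qed.

End NotFinitelyPresented.

Theorem bb_not_finitely_presented (L : scomplex) (x0 : L) : flag L ->
  finite_set [set: L] -> connected L -> (exists g : pi1 x0, g <> 1) ->
  ~ finitely_presented (BB L).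
Proof.
move=> L_flag L_fin L_conn [g g1] [n [R [R_fin [f f_bij]]]]; apply: g1.
have [path_to0 path_to0P] := connected_paths x0 L_conn.
pose path_to u := if u == x0 then [::] else path_to0 u.
have path_toP u : edge_path x0 (path_to u) /\ last x0 (path_to u) = u.
  by rewrite /path_to; case: eqP => [->|_]; [|apply: path_to0P].
have path_to_x0 : path_to x0 = [::] by rewrite /path_to eqxx.
have [s ->] : exists s, g = pi1_class s by apply: (@class_of_surj (pi1_pregroup x0)).
have /asboolP [ps ls] := valP s.
have /choice[W WE] : forall i, exists w, raag_class w = val (f (pres_gen R i)).
  by move=> i; have [w ew] := raag_class_surj (val (f (pres_gen R i))); exists w.
have := loops_trivial L_flag L_fin path_toP R_fin (@gmulfM _ _ f) f_bij WE ps ls.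
by rewrite /path_class ls path_to_x0 /= cats0 loop_class_val.
Qed.
(** * Extensions by a finite group *)

Lemma gact_one (Q N : groupType) (a : gaction Q N) q : a q 1 = 1.
Proof. exact: morph_one (gact_morph a q). Qed.

Section SemidirectPresentation.
Variables (Q N : groupType) (a : gaction Q N).
Hypotheses (Q_fin : finite_set [set: Q]) (N_fp : finitely_presented N).

Lemma sdprod_mul (u v : sdprod a) : u * v = (u.1 * a u.2 v.1, u.2 * v.2).
Proof. by []. Qed.

Lemma sdprod_mull (x y : N) (q : Q) : ((x, 1) : sdprod a) * (y, q) = (x * y, q).
Proof. by rewrite sdprod_mul /= gact1 mul1g. Qed.

(** Generators and relators of the normal subgroup, the multiplication table of the
    quotient, and words for the conjugates of the generators. The inverse of the
    evaluation maps [(g, q)] to the product of the images of [g] and [q]; it is a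
    morphism because of the last relators. *)
Theorem sdprod_finitely_presented : finitely_presented (sdprod a).
Proof.
have [n [R [R_fin [f f_bij]]]] := N_fp.
have fM : {morph f : x y / x * y} := @gmulfM _ _ f.
pose X : choiceType := ('I_n + Q)%type.
pose z i : N := f (pres_gen R i).
have z_eval w : weval z w = f (pres_class R w).
  by rewrite pres_classE (weval_morph _ _ fM).
have /choice[u uE] : forall t : Q * 'I_n, exists w, weval z w = a t.1 (z t.2).
  move=> t; have [h _ fh] := f_bij; have [w ew] := pres_class_surj (h (a t.1 (z t.2))).
  by exists w; rewrite z_eval -ew fh.
pose inN (w : word 'I_n) : word X := [seq (inl b.1, b.2) | b <- w].
pose mul_rel (t : Q * Q) : word X :=
  [:: (inr t.1, true); (inr t.2, true); (inr (t.1 * t.2), false)].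
pose act_rel (t : Q * 'I_n) : word X :=
  [:: (inr t.1, true); (inl t.2, true); (inr t.1, false)] ++ winv (inN (u t)).
pose S : set (word X) := (inN @` R) `|` range mul_rel `|` range act_rel.
pose x (e : X) : sdprod a := match e with inl i => (z i, 1) | inr q => (1, q) end.
have incl_morph : {morph (fun g : N => (g, 1) : sdprod a) : g h / g * h}.
  by move=> g h; rewrite sdprod_mul /= gact1 mulg1.
have x_inN w : weval x (inN w) = (weval z w, 1).
  by rewrite /inN weval_map (weval_morph _ _ incl_morph).
have xV q : ((1, q) : sdprod a)^-1 = (1, q^-1).
  apply: (mulIg ((1, q) : sdprod a)); rewrite mulVg sdprod_mul /=.
  by rewrite gact_one mulg1 mulVg.
have S_hold r : S r -> weval x r = 1.
  move=> [[[w Rw <-]|[t _ <-]]|[t _ <-]].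
  - by rewrite x_inN z_eval pres_class_rel // (morph_one fM).
  - rewrite /= /letter_val /= mulg1 xV !sdprod_mul /=.
    by rewrite !gact_one !mulg1 !gact_one mulg1 mulgA mulgV.
  - rewrite weval_cat weval_winv x_inN uE /= /letter_val /= mulg1 xV.
    set c := _ * (_ * _); suff -> : c = (a t.1 (z t.2), 1) by rewrite mulgV.
    by rewrite /c !sdprod_mul /= gact1 !mul1g mulg1 mulgV.
apply: (@finitely_presentedI X S _ x) => //.
- have -> : [set: X] = range inl `|` range inr.
    by apply/seteqP; split=> // -[i|q] _; [left; exists i | right; exists q].
  by rewrite finite_setU; split; apply: finite_image => //; apply: finite_finset.
- rewrite !finite_setU; do !split; first exact: finite_image.
    apply: finite_image; have -> : [set: Q * Q] = [set: Q] `*` [set: Q].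
      by apply/seteqP; split.
    exact: finite_setX.
  apply: finite_image; have -> : [set: Q * 'I_n] = [set: Q] `*` [set: 'I_n].
    by apply/seteqP; split.
  by apply: finite_setX => //; apply: finite_finset.
- move=> [g q]; have [h _ fh] := f_bij; have [w ew] := pres_class_surj (h g).
  exists (inN w ++ [:: (inr q, true)]); rewrite weval_cat x_inN z_eval -ew fh /=.
  by rewrite mulg1 /letter_val /= sdprod_mul /= gact1 mulg1 mul1g.
pose y := pres_gen S; have y_rel r : S r -> weval y r = 1.
  by move=> Sr; rewrite -pres_classE pres_class_rel.
have [|i0 i0M i0E] := @pres_lift _ R (pres S) (y \o inl).
  move=> r Rr; rewrite -weval_map; apply: y_rel; left; left; by exists r.
have [h fh hf] := f_bij.
have hM : {morph h : g k / g * k} := can2_gmulfM fh hf.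
pose iota g := i0 (h g).
have iotaM : {morph iota : g k / g * k} by move=> g k; rewrite /iota hM i0M.
have iota_z i : iota (z i) = y (inl i) by rewrite /iota /z fh i0E /= mulg1.
pose kappa q := y (inr q).
have kappaM : {morph kappa : q k / q * k}.
  move=> q k; have := y_rel (mul_rel (q, k)).
  rewrite /= /letter_val /= mulg1 mulgA => e; apply/esym/divg1_eq/e.
  by left; right; exists (q, k).
have conj q g : kappa q * iota g * (kappa q)^-1 = iota (a q g).
  have [w ew] := pres_class_surj (h g); have -> : g = weval z w.
    by rewrite z_eval -ew hf.
  elim: w {ew} => [|[i b] w IHw] /=.
    by rewrite gact_one !(morph_one iotaM) mulg1 mulgV.
  have gen : iota (a q (z i)) = kappa q * iota (z i) * (kappa q)^-1.
    have := y_rel (act_rel (q, i)); rewrite weval_cat weval_winv => e.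
    rewrite -(uE (q, i)) (weval_morph _ _ iotaM) iota_z.
    have -> : weval (iota \o z) (u (q, i)) = weval y (inN (u (q, i))).
      by rewrite /inN weval_map; apply: eq_weval => j; apply: iota_z.
    apply/esym/divg1_eq; rewrite -e; last by right; exists (q, i).
    by rewrite /= /letter_val /= mulg1 mulgA.
  have letter : iota (a q (letter_val z (i, b))) =
      kappa q * iota (letter_val z (i, b)) * (kappa q)^-1.
    case: b => //; rewrite /letter_val /= (morph_inv (gact_morph a q)).
    by rewrite !(morph_inv iotaM) gen !invgM invgK mulgA.
  by rewrite gact_morph !iotaM letter -IHw !mulgA mulgVK.
pose Psi (v : sdprod a) := iota v.1 * kappa v.2.
have PsiM : {morph Psi : v w / v * w}.
  move=> v w; rewrite /Psi sdprod_mul /= iotaM kappaM -conj.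
  by rewrite !mulgA mulgVK.
move=> w w1; have := weval_morph x w PsiM; rewrite w1 (morph_one PsiM) => ->.
rewrite pres_classE; apply: eq_weval => -[i|q]; rewrite /= /Psi /=.
  by rewrite iota_z (morph_one kappaM) mulg1.
by rewrite (morph_one iotaM) mul1g.
Qed.

End SemidirectPresentation.

Lemma finite_group_order (Q : groupType) : finite_set [set: Q] ->
  forall q : Q, finite_order q.
Proof.
move=> Q_fin q; have [inj|] := pselect (injective (fun n : nat => q ^+ n)).
  case: infinite_nat; apply: (@finite_preimage _ _ [set: Q] (fun n : nat => q ^+ n)) => //.
  by move=> m n _ _; apply: inj.
move=> /existsNP[m /existsNP[n /not_implyP[]]].
wlog mn : m n / (m <= n)%N.
  by move=> wl; have [|/ltnW] := leqP m n; [apply: wl | move=> nm /esym + /nesym; apply: wl].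
move=> e /eqP nmn; exists (n - m)%N; first by rewrite subn_gt0 ltn_neqAle nmn.
by rewrite expgnFr // -e mulgV.
Qed.

(** The normal factor is torsion-free, and its cosets are the fibres of the second
    projection. *)
Lemma sdprod_virtually_torsion_free (Q N : groupType) (a : gaction Q N) :
  finite_set [set: Q] -> (forall x : N, finite_order x -> x = 1) ->
  virtually_torsion_free (sdprod a).
Proof.
move=> Q_fin N_tf; exists [set u : sdprod a | u.2 = 1]; split.
- split=> [//|x y x1 y1|x x1] /=; first by rewrite x1 y1 mulg1.
  by rewrite x1 invg1.
- move=> [g q] /= -> [n n_gt0 gn].
  have e k : (((g, 1) : sdprod a) ^+ k).1 = g ^+ k.
    elim: k => // k IHk; rewrite !expgS sdprod_mul /= IHk gact1 //.
  by have -> : g = 1 by apply: N_tf; exists n; rewrite // -e gn.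
- apply: (@sub_finite_set _ _
      ((fun q => [set u : sdprod a | u.2 = q]) @` [set: Q])); last first.
    exact: finite_image.
  move=> _ [x _ <-]; exists x.2 => //; apply/seteqP; split=> u /=.
    move=> ux; exists (x^-1 * u); last by rewrite mulVKg.
    by rewrite /= ux mulVg.
  by move=> [h h1 <-] /=; rewrite h1 mulg1.
Qed.
(** * Deck transformations *)

Lemma simplicial_edge_path (K L : scomplex) (f : K -> L) x s :
  simplicial f -> edge_path x s -> edge_path (f x) (map f s).
Proof.
move=> f_simp; elim: s x => //= y s IHs x [xy /IHs ?]; split=> //.
by have := f_simp _ xy; rewrite !imfsetU !imfset_fset1.
Qed.

Lemma belast_map (S T : Type) (f : S -> T) x s :
  belast (f x) (map f s) = map f (belast x s).
Proof. by elim: s x => //= y s IHs x; rewrite IHs. Qed.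

Section Deck.
Variables (L K : scomplex) (p : K -> L) (k0 : K).
Hypothesis p_univ : universal_cover p.
Variable act : deck_action p k0.

(** Take paths from [k0] to [x] and to [y]. The loop in [L] that follows the second
    and comes back along the first lifts to a path through [y] ending at [g k0];
    the first path translated by [g] and the end of that lift, reversed, both start
    at [g k0] and cover the same path, so they end at the same point. *)
Lemma deck_transitive x y : p x = p y -> exists g, act g x = y.
Proof.
have [p_cov [[_ K_conn] _]] := p_univ => pxy.
have [[t kt lt] [t' kt' lt']] := (K_conn k0 x, K_conn k0 y).
pose b := rev (belast k0 t).
have xb : edge_path x b by rewrite -lt; apply: edge_path_rev.
have lb : last x b = k0 by rewrite -lt; apply: last_rev_belast.
have [r yr er] : exists2 r, edge_path y r & map p r = map p b.
  by apply: (lift_path p_cov); rewrite -pxy; apply: (edge_path_map p_cov).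
have kr : edge_path k0 (t' ++ r) by apply/edge_path_cat; rewrite lt'.
have sP : loopb (p k0) (map p (t' ++ r)).
  apply/asboolP; split; first exact: (edge_path_map p_cov).
  by rewrite map_cat last_cat last_map lt' er -pxy last_map lb.
pose s : loop (p k0) := Sub (map p (t' ++ r)) sP.
have gk0 : act (pi1_class s) k0 = last y r.
  by rewrite (dact_lift act (s := s) kr) // last_cat lt'.
exists (pi1_class s); set g := pi1_class s in gk0 *.
have rr : edge_path (act g k0) (rev (belast y r)) by rewrite gk0; apply: edge_path_rev.
have gt : edge_path (act g k0) (map (act g) t).
  exact: simplicial_edge_path (@dact_simplicial _ _ _ _ act g) kt.
have e : map (act g) t = rev (belast y r).
  apply: (lift_path_uniq p_cov gt rr); rewrite map_rev -belast_map er -pxy.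
  have eb : rev (belast x b) = t by rewrite /b -lt rev_belastK.
  rewrite belast_map -map_rev eb -map_comp.
  by apply: eq_map => z /=; rewrite dact_cover.
have := congr1 (last (act g k0)) e.
by rewrite last_map lt gk0 last_rev_belast.
Qed.

Lemma cover_section : exists l : L -> K, forall v, p (l v) = v.
Proof.
have [[_ p_surj _] _] := p_univ.
have /choice[l lP] : forall v, exists x, p x = v.
  by move=> v; have [x _ <-] := p_surj v I; exists x.
by exists l.
Qed.

Lemma cover_finite : finite_set [set: L] -> finite_set [set: pi1 (p k0)] ->
  finite_set [set: K].
Proof.
move=> L_fin pi_fin; have [l lP] := cover_section.
apply: (@sub_finite_set _ _
    ((fun t => act t.2 (l t.1)) @` ([set: L] `*` [set: pi1 (p k0)]))).
  move=> x _; have [|g gx] := @deck_transitive (l (p x)) x; first by rewrite lP.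
  by exists (p x, g).
exact/finite_image/finite_setX.
Qed.

(** * The quotient by the torsion subgroup *)

Hypotheses (L_fin : finite_set [set: L]) (pi_fin : finite_set [set: pi1 (p k0)]).

Let G : groupType := sdprod (bb_action act).

Let move_raag (g : pi1 (p k0)) : raag K -> raag K := raag_map (act g).

(* Closes the side conditions of [raag_map_class] below. *)
Let move_simp g : simplicial (act g). Proof. exact: dact_simplicial. Qed.

Let move_raagM g : {morph move_raag g : x y / x * y}.
Proof. exact: raag_mapM. Qed.

Let move_raag1 x : move_raag 1 x = x.
Proof.
have [w ->] := raag_class_surj x; rewrite /move_raag raag_map_class //.
congr raag_class; rewrite -[RHS]map_id; apply: eq_map => -[v b] /=.
by rewrite dact1.
Qed.

Let move_raag_comp g h x : move_raag (g * h) x = move_raag g (move_raag h x).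
Proof.
have [w ->] := raag_class_surj x; rewrite /move_raag !raag_map_class //.
congr raag_class; rewrite /word_map -map_comp; apply: eq_map => -[v b] /=.
by rewrite dactM.
Qed.

Let p_simp : simplicial p. Proof. by have [[]] := p_univ. Qed.

Let p_move g x : raag_map p (move_raag g x) = raag_map p x.
Proof.
have [w ->] := raag_class_surj x; rewrite /move_raag !raag_map_class //.
congr raag_class; rewrite /word_map -map_comp; apply: eq_map => -[v b] /=.
by rewrite dact_cover.
Qed.

Fact twisted_subproof b g : b / move_raag g b \in @in_BB K.
Proof. by rewrite inE gmulfF /= height_raag_map // divgg. Qed.

(** The conjugate of [g] by [b] in the semidirect product of [raag K] by the
    fundamental group. *)
Definition twisted b g : G :=
  ((Sub (b / move_raag g b) (twisted_subproof b g) : BB K), g).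

(** Its powers are [twisted b (g ^+ k)]. *)
Lemma twisted_finite_order b g : finite_order (twisted b g).
Proof.
have [n n_gt0 gn] := finite_group_order pi_fin g; exists n => //.
have e k : twisted b g ^+ k = twisted b (g ^+ k).
  elim: k => [|k IHk].
    congr (_, _); apply: val_inj => /=.
    rewrite move_raag1 mulgV; exact: (@val1 _ _ (BB K)).
  rewrite expgS IHk sdprod_mul /= /twisted expgS; congr (_, _).
  apply: val_inj; rewrite [LHS](@valM _ _ (BB K)) /=.
  rewrite -/(move_raag g _) move_raagM (morph_inv (move_raagM g)).
  by rewrite -move_raag_comp mulgA mulgVK.
rewrite e gn; congr (_, _); apply: val_inj => /=.
by rewrite move_raag1 mulgV; apply/esym/(@val1 _ _ (BB K)).
Qed.

Let torsion_mem (u : G) : finite_order u -> torsion_set u.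
Proof. by move=> u_tors H [_ HT]; apply: HT. Qed.

Let tors1 : @torsion_set G 1. Proof. by have [] := @torsion_subgroup G. Qed.
Let torsM (u v : G) : torsion_set u -> torsion_set v -> torsion_set (u * v).
Proof. by have [_ + _] := @torsion_subgroup G; apply. Qed.
Let torsV (u : G) : torsion_set u -> torsion_set u^-1.
Proof. by have [_ _] := @torsion_subgroup G; apply. Qed.

(** Conjugates by all of [raag K] are required because the torsion subgroup is a
    priori only normalised by [G]; the result is a normal subgroup of [raag K]. *)
Definition torsion_core : set (raag K) := [set x | forall b,
  exists2 y : BB K, val y = x ^ b & torsion_set ((y, 1) : G)].

Fact torsion_core_subgroup : subgroup torsion_core.
Proof.
split=> [b|x y xT yT b|x xT b].
- by exists 1; [rewrite conj1g; apply: (@val1 _ _ (BB K))|exact: tors1].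
- have [[x' ex x'T] [y' ey y'T]] := (xT b, yT b); exists (x' * y').
    by rewrite conjMg -ex -ey; apply: (@valM _ _ (BB K)).
  have -> : ((x' * y', 1) : G) = ((x', 1) : G) * ((y', 1) : G).
    by rewrite sdprod_mull.
  exact: torsM.
- have [x' ex x'T] := xT b; exists x'^-1.
    by rewrite conjVg -ex; apply: (morph_inv (@valM _ _ (BB K))).
  have -> : ((x'^-1, 1) : G) = ((x', 1) : G)^-1; last exact: torsV.
  apply: (mulIg ((x', 1) : G)); by rewrite mulVg sdprod_mull mulVg.
Qed.

Fact torsion_core_conj x y : torsion_core x -> torsion_core (x ^ y).
Proof. by move=> xT b; rewrite -conjgM; apply: xT. Qed.

Definition core : nsubgroup (raag K) :=
  NSubgroup torsion_core_subgroup torsion_core_conj.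

Let proj (x : raag K) : quotient core := class_of (P := quotient_pregroup core) x.

Let projM : {morph proj : x y / x * y}.
Proof. by move=> x y; apply: (@class_ofM (quotient_pregroup core)). Qed.

Let proj_eqP x y : proj x = proj y <-> torsion_core (x^-1 * y).
Proof. exact: class_of_eqP. Qed.

(** The conjugates of [v^-1 * g v] are quotients of two twisted elements. *)
Lemma proj_gen_move g v : proj (raag_gen v) = proj (raag_gen (act g v)).
Proof.
apply/proj_eqP => b.
have -> : (raag_gen v)^-1 * raag_gen (act g v) =
    (raag_gen v)^-1 * move_raag g (raag_gen v).
  by rewrite /move_raag raag_map_gen.
set x := raag_gen v; set c := b^-1.
pose y1 := (twisted (c / x) g).1; pose y2 := (twisted c g).1.
exists (y1 * y2^-1).
  rewrite [LHS](@valM _ _ (BB K)) (morph_inv (@valM _ _ (BB K))) /=.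
  rewrite move_raagM !(morph_inv (move_raagM g)) conjgE !invgM !invgK.
  by rewrite /c ?invgK !mulgA mulgK.
have -> : ((y1 * y2^-1, 1) : G) = twisted (c / x) g / twisted c g.
  by apply: (mulIg (twisted c g)); rewrite mulgVK sdprod_mull mulgVK.
have tw_tors b' : torsion_set (twisted b' g).
  exact: (torsion_mem (twisted_finite_order b' g)).
exact: torsM (tw_tors _) (torsV (tw_tors _)).
Qed.

(** Modulo the core, generators only depend on their images in [L], and those of
    adjacent vertices of [L] commute since edges lift; so the projection factors
    through the group of [L]. *)
Lemma cover_kernel_core x : raag_map p x = 1 -> torsion_core x.
Proof.
have [p_cov _] := p_univ; have [l lP] := cover_section.
have [w ->] := raag_class_surj x; rewrite raag_map_class // => w1.
pose z v := proj (raag_gen (l v)).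
have z_gen k : z (p k) = proj (raag_gen k).
  have [|g gk] := @deck_transitive k (l (p k)); first by rewrite lP.
  by rewrite /z -gk -proj_gen_move.
have z_rel r : raag_relators r -> weval z r = 1.
  move=> [u [v [[nuv uv] ->]]]; rewrite /= /letter_val /= mulg1.
  apply/commutator_eq1; move: uv; rewrite -(lP u) => uv.
  have [k luk <-] := lift_edge p_cov uv.
  by rewrite !z_gen /commute -!projM (raag_gen_commute luk).
have w1' : pres_eq (@raag_relators L) (word_map p w) [::] by apply/raag_class_eqP.
have : proj (raag_class w) = proj 1.
  rewrite raag_classE (weval_morph _ _ projM) (morph_one projM).
  rewrite -[1]/(weval z [::]) -(weval_pres_eq z_rel w1') /word_map weval_map.
  by apply: eq_weval => k /=; rewrite z_gen.
move=> /esym/proj_eqP; by rewrite invg1 mul1g.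
Qed.

Fact cover_bb_subproof (u : G) : raag_map p (val u.1) \in @in_BB L.
Proof. by rewrite inE height_raag_map //; apply: valP u.1. Qed.

Definition cover_bb (u : G) : BB L :=
  Sub (raag_map p (val u.1)) (cover_bb_subproof u).

(** The action disappears in the second factor, as deck transformations preserve the
    covering. *)
Lemma cover_bbM : {morph cover_bb : u v / u * v}.
Proof.
move=> u v; apply: val_inj; rewrite [RHS](@valM _ _ (BB L)) /=.
by rewrite (raag_mapM p_simp) -/(move_raag _ _) p_move.
Qed.

Lemma cover_bb_surj x : exists u, cover_bb u = x.
Proof.
have [l lP] := cover_section; have [w ew] := raag_class_surj (val x).
have hw : raag_class (word_map l w) \in @in_BB K.
  have := valP x; rewrite ew !inE !height_class /exponent_sum big_map => /eqP e.
  by apply/eqP; rewrite -[RHS]e; apply: eq_bigr.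
pose y : BB K := Sub (raag_class (word_map l w)) hw.
exists (y, 1); apply: val_inj; rewrite /= raag_map_class // ew.
congr raag_class; rewrite /word_map -map_comp -[RHS]map_id.
by apply: eq_map => -[v b] /=; rewrite lP.
Qed.

(** An element [(x, g)] of the kernel is the product of [(x, 1)], with [x] in the
    core, and of [g], of finite order. *)
Lemma cover_bb_kernel u : cover_bb u = 1 <-> torsion_set u.
Proof.
split=> [|u_tors].
  move=> /(congr1 val) /= e.
  have u1 : raag_map p (val u.1) = 1 by rewrite e; apply: (@val1 _ _ (BB L)).
  have [y ey y_tors] := cover_kernel_core u1 1.
  have -> : u = ((y, 1) : G) * twisted 1 u.2.
    rewrite sdprod_mull; case: (u) ey => x g /= ey; congr (_, _); apply: val_inj.
    rewrite [RHS](@valM _ _ (BB K)) /= ey conjg1 (morph_one (move_raagM g)).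
    by rewrite invg1 !mulg1.
  exact: torsM y_tors (torsion_mem (twisted_finite_order _ _)).
apply: (u_tors [set v | cover_bb v = 1]); split=> [|v [n n_gt0 vn]].
  split=> [|x y x1 y1|x x1] /=; first exact: morph_one cover_bbM.
    by rewrite cover_bbM x1 y1 mulg1.
  by rewrite (morph_inv cover_bbM) x1 invg1.
apply: bb_torsion_free; exists n => //.
by rewrite -(morph_exp cover_bbM) vn (morph_one cover_bbM).
Qed.

Theorem torsion_quotient : isomorphic (quotient (Tor G)) (BB L).
Proof. exact: (@first_isomorphism G (BB L) (Tor G) cover_bb cover_bbM cover_bb_surj
  cover_bb_kernel). Qed.

End Deck.

Theorem mainTheorem3 (L K : scomplex) (p : K -> L) (k0 : K)
    (L_finite : finite_set [set: L]) (L_flag : flag L)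
    (L_connected : connected L)
    (pi_finite : finite_set [set: pi1 (p k0)])
    (pi_nontrivial : exists g : pi1 (p k0), g <> 1%g)
    (p_universal : universal_cover p)
    (act : deck_action p k0) :
  let G : groupType := sdprod (bb_action act) in
  [/\ finitely_presented G, virtually_torsion_free G,
      isomorphic (quotient (Tor G)) (BB L),
      recursively_presented (BB L) &
      ~ finitely_presented (BB L)].
Proof.
move=> G; have K_finite := cover_finite p_universal act L_finite pi_finite.
split.
- exact: sdprod_finitely_presented pi_finite
    (bb_finitely_presented k0 p_universal.2 K_finite).
- exact: sdprod_virtually_torsion_free pi_finite (@bb_torsion_free K).
- exact: torsion_quotient.
- exact: bb_recursively_presented.
- exact: bb_not_finitely_presented L_flag L_finite L_connected pi_nontrivial.
Qed.
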